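(* Let $(X,\mu)$ be a connected $d$-partite path complex which is a $\tfrac12$-top-link spectral expander. Then the spectral gap (Poincaré constant) of the down-up walk $P^\vee_d$ is at least $\frac{4}{d(d+1)^2}$. Consequently, for every facet $\tau\in X(d)$ and every $\epsilon>0$, $$t_\tau(\epsilon)\le \frac{d(d+1)^2}{4}\log\frac{1}{\epsilon\,\mu(\tau)}.$$
   Context: A simplicial complex $X$ on a finite ground set is a downward-closed family of subsets; $X(i)$ denotes faces of size $i$; $X$ is pure $d$-dimensional if all facets have size $d$; $\operatorname{codim}(\tau)=d-|\tau|$; the link of $\tau$ is $X_\tau=\{\sigma\setminus\tau:\sigma\in X,\sigma\supseteq\tau\}$. $X$ is $d$-partite if $X(1)=T_1\sqcup\dots\sqcup T_d$ with $|\sigma\cap T_i|=1$ for every facet $\sigma$ and every $i$. $\mu:X(d)\to\mathbb{R}_{>0}$ is a probability distribution on facets. For $\tau$ with $\operatorname{codim}(\tau)\ge 2$, $G_\tau$ is the weighted graph on $X_\tau(1)$ with edge set $X_\tau(2)$ and weights $w_\tau(F,G)=\mathbb{P}_{\sigma\sim\mu}[F,G\in\sigma\mid\tau\subseteq\sigma]$, and $P_\tau$ is its simple random walk matrix; $\lambda_2$ is the second largest eigenvalue. $(X,\mu)$ is connected if every such $G_\tau$ is connected; it is an $\alpha$-top-link spectral expander if $\lambda_2(P_\tau)\le\alpha$ whenever $\operatorname{codim}(\tau)=2$. $(X,\mu)$ is a path complex if (after possibly renaming parts) for all $1\le i<k-1\le d-1$, $F\in T_i$, $K\in T_k$ and every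 face $\tau$ with $\tau\cap\bigcup_{j=i+1}^{k-1}T_j\ne\emptyset$: $\mathbb{P}[F,K\in\sigma\mid\tau\subseteq\sigma]=\mathbb{P}[F\in\sigma\mid\tau\subseteq\sigma]\mathbb{P}[K\in\sigma\mid\tau\subseteq\sigma]$ ($\sigma\sim\mu$). The down-up walk $P^\vee_d$ on $X(d)$: from a facet $\sigma=\{F_1,\dots,F_d\}$ with $F_i\in T_i$, choose $i\in[d]$ uniformly at random and move to $\sigma'=\{F_1,\dots,F_{i-1},F,F_{i+1},\dots,F_d\}\in X(d)$ (over all $F\in T_i$ with $\sigma'\in X(d)$) with probability proportional to $\mu(\sigma')$. Its spectral gap is $\inf_f \mathcal{E}(f,f)/\mathrm{Var}_\mu(f)$ over non-constant $f:X(d)\to\mathbb{R}$, where $\mathcal{E}(f,f)=\tfrac12\sum_{x,y}\mu(x)P^\vee_d(x,y)(f(x)-f(y))^2$ and $\mathrm{Var}_\mu(f)=\mathbb{E}_\mu f^2-(\mathbb{E}_\mu f)^2$. The total variation mixing time from $\tau$ is $t_\tau(\epsilon)=\min\{t\in\mathbb{Z}_{\ge0}:\|(P^\vee_d)^t(\tau,\cdot)-\mu\|_1\le\epsilon\}$.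
   Formalization: The mixing bound is proved literally for d ≥ 2 and εμ(τ) ≤ 1; it fails for εμ(τ) > 1 (negative bound) and can fail for d = 1 (integer rounding), so for all d ≥ 1 and ε > 0 the bound proved is max(0, ⌈·⌉) of the right-hand side. *)

(* Defs.v *)
From HB Require Import structures.
From mathcomp Require Import all_boot all_order all_fingroup all_algebra.
From mathcomp Require Import polyrcf.
From mathcomp Require Import classical_sets reals ereal exp.

Set Implicit Arguments.
Unset Strict Implicit.
Unset Printing Implicit Defensive.

Import Order.TTheory GRing.Theory Num.Theory.

Local Open Scope ring_scope.

(** * Simplicial complexes *)

Definition simplicial_complex (V : finType) (X : {set {set V}}) : Prop :=
  forall s t : {set V}, s \in X -> t \subset s -> t \in X.

(* [faces X i] is X(i), the faces of SIZE i. *)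
Definition faces (V : finType) (X : {set {set V}}) (i : nat) : {set {set V}} :=
  [set s in X | #|s| == i]%SET.

(* X(1), its one-element faces being identified with their elements. *)
Definition vertices (V : finType) (X : {set {set V}}) : {set V} :=
  [set v | [set v]%SET \in X]%SET.

Definition is_facet (V : finType) (X : {set {set V}}) (s : {set V}) : Prop :=
  maxset (fun t : {set V} => t \in X) s.

Definition pure (V : finType) (X : {set {set V}}) (d : nat) : Prop :=
  forall s : {set V}, is_facet X s -> #|s| = d.

Definition codim (V : finType) (d : nat) (t : {set V}) : nat := (d - #|t|)%N.

Definition link (V : finType) (X : {set {set V}}) (t : {set V}) :
    {set {set V}} :=
  [set s :\: t | s in X & t \subset s]%SET.

Definition partite (V : finType) (X : {set {set V}}) (d : nat)
    (T : 'I_d -> {set V}) : Prop :=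
  [/\ forall v : V, v \in vertices X <-> exists i, v \in T i,
      forall i j : 'I_d, i != j -> [disjoint T i & T j]
    & forall s : {set V}, is_facet X s -> forall i, #|(s :&: T i)%SET| = 1%N].

(** * Distributions on facets *)

(* Only the values of mu on X(d) are meaningful. *)
Definition facet_distribution (R : realType) (V : finType)
    (X : {set {set V}}) (d : nat) (mu : {set V} -> R) : Prop :=
  (forall s, s \in faces X d -> 0 < mu s) /\ \sum_(s in faces X d) mu s = 1.

Definition prob (R : realType) (V : finType) (X : {set {set V}}) (d : nat)
    (mu : {set V} -> R) (A : pred {set V}) : R :=
  \sum_(s in faces X d | A s) mu s.

(* P_{s ~ mu}[ A s | t \subset s ] *)
Definition cprob (R : realType) (V : finType) (X : {set {set V}}) (d : nat)
    (mu : {set V} -> R) (A : pred {set V}) (t : {set V}) : R :=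
  prob X d mu (fun s => A s && (t \subset s)) /
  prob X d mu (fun s => t \subset s).

(** * The weighted graphs of the links and their random walks *)

Definition link_edge (V : finType) (X : {set {set V}}) (t : {set V}) : rel V :=
  fun F G => [set F; G]%SET \in faces (link X t) 2.

(* There are no loops: w_t(F, F) = 0. *)
Definition link_weight (R : realType) (V : finType) (X : {set {set V}})
    (d : nat) (mu : {set V} -> R) (t : {set V}) (F G : V) : R :=
  if link_edge X t F G
  then cprob X d mu (fun s => (F \in s) && (G \in s)) t
  else 0.

Definition link_walk (R : realType) (V : finType) (X : {set {set V}})
    (d : nat) (mu : {set V} -> R) (t : {set V}) :
    'M[R]_#|vertices (link X t)| :=
  \matrix_(i, j)
    (link_weight X d mu t (enum_val i) (enum_val j) /
     \sum_(H in vertices (link X t)) link_weight X d mu t (enum_val i) H).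

(* The real eigenvalues of A, repeated according to their algebraic
   multiplicity, in nonincreasing order. *)
Definition eigenvalues (R : realType) (n : nat) (A : 'M[R]_n) : seq R :=
  sort (fun x y => y <= x)
    (flatten [seq nseq (mup x (char_poly A)) x | x <- rootsR (char_poly A)]).

Definition lambda2 (R : realType) (n : nat) (A : 'M[R]_n) : R :=
  nth 0 (eigenvalues A) 1.

Definition connected_complex (V : finType) (X : {set {set V}}) (d : nat) :
    Prop :=
  forall t : {set V}, t \in X -> (2 <= codim d t)%N ->
  {in vertices (link X t) &, forall F G : V, connect (link_edge X t) F G}.

Definition top_link_expander (R : realType) (V : finType) (X : {set {set V}})
    (d : nat) (mu : {set V} -> R) (alpha : R) : Prop :=
  forall t : {set V}, t \in X -> codim d t = 2 ->
  lambda2 (link_walk X d mu t) <= alpha.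

(* The permutation p renames the parts; parts are numbered from 0. *)
Definition path_complex (R : realType) (V : finType) (X : {set {set V}})
    (d : nat) (T : 'I_d -> {set V}) (mu : {set V} -> R) : Prop :=
  exists p : 'S_d,
  forall (i k : 'I_d), (i.+1 < k)%N ->
  forall (F K : V), F \in T (p i) -> K \in T (p k) ->
  forall t : {set V}, t \in X ->
  (exists2 j : 'I_d, (i < j < k)%N & (t :&: T (p j))%SET != finset.set0) ->
  cprob X d mu (fun s => (F \in s) && (K \in s)) t =
  cprob X d mu (fun s => F \in s) t * cprob X d mu (fun s => K \in s) t.

(** * The down-up walk *)

(* For facets s and s', s' arises from s by replacing its element of T i by
   some (possibly the same) element of T i. *)
Definition replaces (V : finType) (d : nat) (T : 'I_d -> {set V}) (i : 'I_d)
    (s s' : {set V}) : bool :=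
  [exists F in T i, s' == (F |: (s :\: T i))%SET].

Definition down_up (R : realType) (V : finType) (X : {set {set V}}) (d : nat)
    (T : 'I_d -> {set V}) (mu : {set V} -> R) (s s' : {set V}) : R :=
  \sum_(i < d) d%:R^-1 *
    (if replaces T i s s'
     then mu s' / \sum_(r in faces X d | replaces T i s r) mu r
     else 0).

(* t-step transition probabilities of the walk on X(d). *)
Fixpoint down_up_iter (R : realType) (V : finType) (X : {set {set V}})
    (d : nat) (T : 'I_d -> {set V}) (mu : {set V} -> R) (t : nat)
    (s s' : {set V}) : R :=
  if t is t'.+1
  then \sum_(r in faces X d)
         down_up X T mu s r * down_up_iter X T mu t' r s'
  else (s == s')%:R.

Definition dirichlet (R : realType) (V : finType) (X : {set {set V}})
    (d : nat) (T : 'I_d -> {set V}) (mu : {set V} -> R) (f : {set V} -> R) : R :=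
  2^-1 * \sum_(x in faces X d) \sum_(y in faces X d)
           mu x * down_up X T mu x y * (f x - f y) ^+ 2.

Definition variance_on (R : realType) (V : finType) (X : {set {set V}})
    (d : nat) (mu : {set V} -> R) (f : {set V} -> R) : R :=
  \sum_(x in faces X d) mu x * f x ^+ 2 -
  (\sum_(x in faces X d) mu x * f x) ^+ 2.

Definition nonconstant_on (R : realType) (V : finType) (X : {set {set V}})
    (d : nat) (f : {set V} -> R) : Prop :=
  exists x y, [/\ x \in faces X d, y \in faces X d & f x <> f y].

(* Extended-real valued, the infimum being +oo when X has a single facet. *)
Definition spectral_gap (R : realType) (V : finType) (X : {set {set V}})
    (d : nat) (T : 'I_d -> {set V}) (mu : {set V} -> R) : \bar R :=
  ereal_inf [set g : \bar R | exists2 f : {set V} -> R, nonconstant_on X d f &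
               g = (dirichlet X T mu f / variance_on X d mu f)%:E]%classic.

Definition l1_distance (R : realType) (V : finType) (X : {set {set V}})
    (d : nat) (T : 'I_d -> {set V}) (mu : {set V} -> R) (tau : {set V})
    (t : nat) : R :=
  \sum_(s in faces X d) `|down_up_iter X T mu t tau s - mu s|.

(* A minimum over natural numbers, taken in the extended reals so that it is
   +oo if there is no such t. *)
Definition mixing_time (R : realType) (V : finType) (X : {set {set V}})
    (d : nat) (T : 'I_d -> {set V}) (mu : {set V} -> R) (tau : {set V})
    (eps : R) : \bar R :=
  ereal_inf [set g : \bar R | exists2 t : nat,
               l1_distance X T mu tau t <= eps & g = (t%:R)%:E]%classic.

(* This is negative when eps * mu tau > 1, and for d = 1 it can lie strictly
   between 0 and the (integral) mixing time: for mu uniform on two facets and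
   eps = 9/10 the mixing time is 1 but the bound is ln (20/9) < 1. *)
Definition mixing_bound (R : realType) (V : finType) (d : nat)
    (mu : {set V} -> R) (tau : {set V}) (eps : R) : R :=
  (d * d.+1 ^ 2)%:R / 4 * ln (1 / (eps * mu tau)).

(* Main.v *)
Require Import Defs.
From HB Require Import structures.
From mathcomp Require Import all_boot all_order all_fingroup all_algebra.
From mathcomp Require Import polyrcf complex.
From mathcomp Require Import classical_sets reals ereal sequences exp.
From mathcomp Require Import ring lra fintype finset.

(** In L^2(mu), let Q_i be the conditional expectation that resamples the vertex
    of part i, so that the down-up walk is the average of the Q_i, and put
    P_i = 1 - Q_i and L = sum_i P_i.  The top-link condition bounds the
    correlation of functions fixed by Q_i and by Q_j, inside each link of
    codimension 2, by 1/2; the path condition makes it 0 when i and j are not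
    consecutive.  Passing to the complementary projections, this gives
      2 <P_i f, P_j f> >= - eps (s |P_i f|^2 + |P_j f|^2 / s)
    for all s > 0, with eps = 1/2 or eps = 0 respectively.  Expanding |L f|^2 and
    choosing s = phi_j / phi_i, phi_k = k (d + 1 - k), yields
      |L f|^2 >= 4 / (d + 1)^2 <L f, f>,
    hence every nonzero eigenvalue of L is at least 4 / (d + 1)^2.  Connectedness
    of the links says that the kernel of L consists of the constants, and this is
    the spectral gap.  As the walk is positive semidefinite, the gap controls the
    decay of the chi-square distance to mu, and with it the mixing time. *)

Set Implicit Arguments.
Unset Strict Implicit.
Unset Printing Implicit Defensive.

Import Order.TTheory GRing.Theory Num.Theory.

Local Open Scope ring_scope.

(** * The second eigenvalue of a reversible walk *)

(** Lifted to constant polynomials, [U] intertwines the two characteristic matrices, and its nonzero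
    determinant cancels in the integral domain of polynomials. *)
Lemma char_poly_intertwine (F : fieldType) (n : nat) (U A B : 'M[F]_n) :
  U \in unitmx -> U *m A = B *m U -> char_poly A = char_poly B.
Proof.
move=> Uunit UA; pose Up := map_mx polyC U.
have UAp : Up *m char_poly_mx A = char_poly_mx B *m Up.
  rewrite /char_poly_mx mulmxBr mulmxBl -!map_mxM UA.
  by rewrite mul_mx_scalar mul_scalar_mx.
have detU : \det Up != 0.
  by rewrite det_map_mx polyC_eq0 -unitfE -unitmxE.
apply: (mulfI detU); rewrite /char_poly -det_mulmx UAp det_mulmx.
by rewrite mulrC.
Qed.

(** Both lists are sorted, so it suffices that each [x] occurs equally often in them; on either side
    that number is the multiplicity of [x] as a root. *)
Lemma eigenvalues_prod (R : realType) (n : nat) (A : 'M[R]_n) (s : seq R) :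
  char_poly A = \prod_(x <- s) ('X - x%:P) ->
  eigenvalues A = sort (fun x y => y <= x) s.
Proof.
move=> Es; rewrite /eigenvalues Es.
set p := \prod_(x <- s) _; have p0 : p != 0.
  by rewrite monic_neq0 // monic_prod_XsubC.
apply/perm_sortP; first by move=> x y; exact: le_total.
- by move=> y x z xy yz; exact: le_trans yz xy.
- by move=> x y /andP[yx xy]; apply: le_anti; rewrite xy yx.
apply/allP => x _ /=; apply/eqP; rewrite -(mu_prod_XsubC x s) -/p.
rewrite count_flatten -map_comp.
have -> : forall r, uniq r ->
    sumn [seq (count_mem x \o fun y => nseq (mup y p) y) i | i <- r] =
    (if x \in r then mup x p else 0)%N.
- elim=> [|y r IHr] //= /andP[yr Ur]; rewrite IHr // count_nseq /= in_cons eq_sym.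
  have [->|yx] := eqVneq x y; first by rewrite (negPf yr) addn0 mul1n.
  by rewrite mul0n.
- case: ifPn => // xr; apply/esym/mupNroot; apply: contra xr => xp.
  by rewrite -(roots_on_rootsR p0) /=.
- by rewrite /rootsR uniq_roots.
Qed.

(** In the sorted list every entry after the first is at most [c], so at most one index carries an
    eigenvalue above [c]. The pairwise form says this without naming the exceptional index. *)
Lemma lambda2_le (R : realType) (n : nat) (A : 'M[R]_n) (lam : 'I_n -> R) (c : R) :
  char_poly A = \prod_i ('X - (lam i)%:P) -> lambda2 A <= c ->
  forall i j : 'I_n, i != j -> lam i <= c \/ lam j <= c.
Proof.
move=> EA; pose s := codom lam.
have Es : char_poly A = \prod_(x <- s) ('X - x%:P).
  by rewrite EA /s /codom /image_mem big_map big_enum.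
rewrite /lambda2 (eigenvalues_prod Es).
set l := sort _ _ => lc.
pose gtc : pred R := fun x => c < x.
have cnt : (count gtc s <= 1)%N.
  have /seq.permP <- : perm_eq l s by rewrite perm_sort.
  have : sorted (fun x y => y <= x) l.
    by apply: sort_sorted => x y; exact: le_total.
  (* In lists of length at most one, where [lambda2] is the default 0, at most one entry can exceed
     [c] anyway. *)
  case: l lc => [|x0 [|x1 l]] //=; first by case: (gtc x0).
  move=> x1c /andP[_]; rewrite path_sortedE; last first.
    by move=> y x z xy yz; exact: le_trans yz xy.
  move=> /andP[/allP lx1 _].
  rewrite [gtc x1]ltNge x1c add0n.
  suff -> : count gtc l = 0%N by case: (gtc x0).
  apply/eqP; rewrite -leqn0 leqNgt -has_count; apply/hasPn => y /lx1 yx1.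
  by rewrite /gtc -leNgt (le_trans yx1).
move=> i j ij; have [|ci] := leP (lam i) c; first by left.
have [|cj] := leP (lam j) c; first by right.
move: cnt; rewrite /s /codom /image_mem count_map -size_filter.
move=> cnt; exfalso.
suff : (1 < size [seq k <- enum 'I_n | gtc (lam k)])%N by rewrite ltnNge cnt.
apply: (@uniq_leq_size _ [:: i; j]); first by rewrite /= inE ij.
by move=> k; rewrite !inE mem_filter mem_enum => /orP[] /eqP ->; rewrite /gtc ?ci ?cj.
Qed.

Section RealSymmetric.
Local Open Scope sesquilinear_scope.
Variables (R : rcfType) (n : nat) (S : 'M[R]_n).
Hypothesis S_sym : S^T = S.

(** Over the complex numbers [S] is hermitian, hence unitarily diagonalizable with real eigenvalues;
    its characteristic polynomial therefore splits over [R], and only the change of basis stays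
    complex. *)
Lemma real_spectral : exists (lam : 'I_n -> R) (U : 'M[R[i]]_n),
  [/\ U \is unitarymx,
      map_mx (real_complex R) S =
        U^t* *m diag_mx (\row_i (real_complex R (lam i))) *m U
    & char_poly S = \prod_i ('X - (lam i)%:P)].
Proof.
pose SC := map_mx (real_complex R) S.
have SCh : SC \is hermsymmx.
  apply/is_hermitianmxP; rewrite expr0 scale1r; apply/matrixP => i j.
  rewrite !mxE -{1}S_sym mxE; apply/esym/CrealP.
  by rewrite complex_real.
have SCn := hermitian_normalmx SCh.
pose U := spectralmx SC; pose D := spectral_diag SC.
have Uu : U \is unitarymx := spectral_unitarymx SC.
have ESC : SC = invmx U *m diag_mx D *m U by exact/orthomx_spectralP.
have Dr : D \is a realmx by exact: hermitian_spectral_diag_real.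
pose lam i := complex.Re (D 0 i).
have ED : D = \row_i (real_complex R (lam i)).
  by apply/rowP => i; rewrite mxE RRe_real //; exact: (mxOverP Dr).
exists lam, U; split => //.
  by rewrite -/SC {1}ESC ED invmx_unitary.
apply: (map_poly_inj (real_complex R)); rewrite map_char_poly -/SC.
rewrite (@char_poly_intertwine _ _ U SC (diag_mx D)) ?unitarymx_unit //; last first.
  by rewrite ESC !mulmxA mulmxV ?mul1mx // unitarymx_unit.
rewrite char_poly_trig ?diag_mx_is_trig // rmorph_prod /=.
apply: eq_bigr => i _; rewrite mxE eqxx mulr1n ED mxE.
by rewrite rmorphB /= map_polyX map_polyC.
Qed.

End RealSymmetric.

Section SecondEigenvalue.
Local Open Scope sesquilinear_scope.

(** In an eigenbasis [e] is supported on the eigenvalue 1, which exceeds [c], and only one index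
    [i0] can exceed [c]. So [e] spans that eigenline, [g] has no component along it, and the
    remaining eigenvalues are at most [c]. *)
Lemma symmetric_lambda2_le (R : realType) (n : nat) (S : 'M[R]_n)
    (e g : 'cV[R]_n) (c : R) :
  S^T = S -> S *m e = e -> e != 0 -> c < 1 -> lambda2 S <= c ->
  g^T *m e = 0 -> (g^T *m S *m g) 0 0 <= c * (g^T *m g) 0 0.
Proof.
move=> S_sym Se e0 c1 S2 ge.
have [lam [U [Uu ES chS]]] := real_spectral S_sym.
have lam2 := lambda2_le chS S2.
pose D := diag_mx (\row_i (real_complex R (lam i))).
pose toC m (A : 'M[R]_(m, 1)) := map_mx (real_complex R) A.
have UU : U *m U^t* = 1%:M by exact/unitarymxP.
have U'U : U^t* *m U = 1%:M by exact: mulmx1C.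
have toC_adj (h : 'cV[R]_n) : (toC n h)^t* = map_mx (real_complex R) h^T.
  apply/matrixP => i j; rewrite !mxE; apply/CrealP.
  by rewrite complex_real.
pose y := U *m toC n g; pose z := U *m toC n e.
have y_adj : y^t* = map_mx (real_complex R) g^T *m U^t*.
  by rewrite /y trmx_mul map_mxM toC_adj.
have Dz : D *m z = z.
  rewrite /z -{2}Se [toC _ (S *m e)]map_mxM ES -/D !mulmxA.
  by rewrite UU mul1mx.
have z_lam i : z i 0 != 0 -> lam i = 1.
  move=> zi; have /matrixP/(_ i 0) := Dz.
  rewrite mul_diag_mx mxE [X in X * _ = _]mxE -[X in _ = X]mul1r.
  by move=> /(mulIf zi)/complexI.
have [i0 zi0] : exists i, z i 0 != 0.
  apply/existsP; apply: contraNT e0; rewrite negb_exists => /forallP z0.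
  suff : toC n e = 0.
    move/matrixP => E; apply/eqP/matrixP => i j.
    by have := E i j; rewrite !mxE => /complexI.
  rewrite -[toC n e]mul1mx -U'U -mulmxA -/z.
  suff -> : z = 0 by rewrite mulmx0.
  by apply/colP => i; move/negPn/eqP: (z0 i) => ->; rewrite mxE.
have lam_le i : i != i0 -> lam i <= c.
  move=> ii0; have [//|] := lam2 _ _ ii0; rewrite (z_lam _ zi0) leNgt c1 //.
have z0 i : i != i0 -> z i 0 = 0.
  move=> /lam_le lc; apply/eqP; apply: contraT => /z_lam E.
  by move: lc; rewrite E leNgt c1.
(* [U] preserves the orthogonality of [g] and [e]; as [z] is supported at [i0], the coordinate of
   [y] there must vanish. *)
have yz : y^t* *m z = 0.
  rewrite y_adj /z mulmxA mulmxKtV ?trmx_unitary //.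
  by rewrite -map_mxM ge map_mx0.
have yi0 : y i0 0 = 0.
  have /matrixP/(_ 0 0) := yz; rewrite mxE (bigD1 i0) //= big1 ?addr0; last first.
    by move=> i /z0 ->; rewrite mulr0.
  rewrite [in RHS]mxE => /eqP; rewrite mulf_eq0 (negPf zi0) orbF !mxE conjC_eq0.
  by move/eqP.
have Eg : real_complex R ((g^T *m g) 0 0) = \sum_i `|y i 0| ^+ 2.
  have -> : real_complex R ((g^T *m g) 0 0) = (y^t* *m y) 0 0.
    rewrite y_adj /y mulmxA mulmxKtV ?trmx_unitary // -map_mxM.
    by rewrite [in RHS]mxE.
  by rewrite mxE; apply: eq_bigr => i _; rewrite !mxE mulrC -normCK.
have ESg : real_complex R ((g^T *m S *m g) 0 0) =
    \sum_i real_complex R (lam i) * `|y i 0| ^+ 2.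
  have -> : real_complex R ((g^T *m S *m g) 0 0) = (y^t* *m D *m y) 0 0.
    rewrite y_adj /y.
    have -> : map_mx (real_complex R) g^T *m U^t* *m D *m (U *m toC n g) =
        map_mx (real_complex R) g^T *m (U^t* *m D *m U) *m toC n g.
      by rewrite !mulmxA.
    by rewrite -ES -!map_mxM [in RHS]mxE.
  rewrite mxE; apply: eq_bigr => i _; rewrite mul_mx_diag !mxE normCK.
  by rewrite mulrAC mulrC; congr (_ * _); rewrite mulrC.
rewrite -lecR ESg rmorphM /= Eg mulr_sumr; apply: ler_sum => i _.
have [->|/lam_le lc] := eqVneq i i0; first by rewrite yi0 normr0 expr0n !mulr0.
by rewrite ler_wpM2r ?exprn_ge0 // lecR.
Qed.

(** Conjugating [P] by the square roots of the degrees gives a symmetric [S] with the same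
    characteristic polynomial, which fixes the vector [e] of these roots. A zero weighted mean of
    [g] becomes orthogonality of [h] and [e]. *)
Lemma reversible_lambda2_le (R : realType) (n : nat) (W P : 'M[R]_n)
    (g deg : 'I_n -> R) (c : R) :
  W^T = W -> (forall i, deg i = \sum_j W i j) -> (forall i, 0 < deg i) ->
  (forall i j, P i j = W i j / deg i) -> c < 1 -> lambda2 P <= c ->
  \sum_i deg i * g i = 0 ->
  \sum_i \sum_j W i j * (g i * g j) <= c * \sum_i deg i * g i ^+ 2.
Proof.
move=> W_sym Edeg deg0 EP c1 P2 g0.
(* Dimension 0 is split off because [e] has to be nonzero. *)
case: n W P g deg W_sym Edeg deg0 EP P2 g0 => [|n] W P g deg W_sym Edeg deg0 EP P2 g0.
  by rewrite !big_ord0 mulr0.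
pose q i := Num.sqrt (deg i).
have q0 i : q i != 0 by rewrite lt0r_neq0 // sqrtr_gt0.
have qq i : q i * q i = deg i by rewrite -expr2 sqr_sqrtr // ltW.
pose S : 'M[R]_n.+1 := \matrix_(i, j) (W i j / (q i * q j)).
pose e : 'cV[R]_n.+1 := \col_i q i.
pose h : 'cV[R]_n.+1 := \col_i (q i * g i).
have S_sym : S^T = S.
  by apply/matrixP => i j; rewrite !mxE -{1}W_sym mxE [q j * _]mulrC.
have chS : char_poly P = char_poly S.
  apply: (@char_poly_intertwine _ _ (diag_mx e^T)).
    rewrite unitmxE det_diag unitfE; apply/prodf_neq0 => i _.
    by rewrite !mxE.
  apply/matrixP => i j; rewrite mul_diag_mx mul_mx_diag !mxE EP -qq.
  by field; rewrite !q0.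
have S2 : lambda2 S <= c.
  by move: P2; rewrite /lambda2 /eigenvalues chS.
have Se : S *m e = e.
  apply/colP => i; rewrite !mxE.
  under eq_bigr => j _.
    rewrite !mxE (_ : _ * _ = W i j / q i); first over.
    by field; rewrite !q0.
  by rewrite -mulr_suml -Edeg -qq mulfK.
have e0 : e != 0.
  by apply/eqP => /colP/(_ 0); rewrite !mxE => /eqP; rewrite (negPf (q0 _)).
have he : h^T *m e = 0.
  apply/matrixP => i j; rewrite !ord1 [LHS]mxE [RHS]mxE -[RHS]g0; apply: eq_bigr => k _.
  by rewrite !mxE -qq; ring.
have := symmetric_lambda2_le S_sym Se e0 c1 S2 he.
have -> : (h^T *m h) 0 0 = \sum_i deg i * g i ^+ 2.
  by rewrite mxE; apply: eq_bigr => i _; rewrite !mxE -qq; ring.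
have -> // : (h^T *m S *m h) 0 0 = \sum_i \sum_j W i j * (g i * g j).
rewrite exchange_big [LHS]mxE /=; apply: eq_bigr => j _; rewrite mxE mulr_suml.
apply: eq_bigr => i _; rewrite !mxE.
by field; rewrite !q0.
Qed.

End SecondEigenvalue.

(** * Projections in a finite-dimensional inner product space *)

Section InnerProduct.
Variables (R : realFieldType) (H : vectType R) (ip : H -> H -> R).
Hypothesis ipC : forall x y, ip x y = ip y x.
Hypothesis ipDl : forall x y z, ip (x + y) z = ip x z + ip y z.
Hypothesis ipZl : forall a x y, ip (a *: x) y = a * ip x y.
Hypothesis ip_ge0 : forall x, 0 <= ip x x.
Hypothesis ip_eq0 : forall x, ip x x = 0 -> x = 0.

Definition self_adjoint (A : 'End(H)) := forall x y, ip (A x) y = ip x (A y).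

Lemma ipNl x y : ip (- x) y = - ip x y.
Proof. by rewrite -scaleN1r ipZl mulN1r. Qed.
Lemma ipBl x y z : ip (x - y) z = ip x z - ip y z.
Proof. by rewrite ipDl ipNl. Qed.
Lemma ipDr x y z : ip z (x + y) = ip z x + ip z y.
Proof. by rewrite ![ip z _]ipC ipDl. Qed.
Lemma ipBr x y z : ip z (x - y) = ip z x - ip z y.
Proof. by rewrite ![ip z _]ipC ipBl. Qed.
Lemma ipZr a x y : ip x (a *: y) = a * ip x y.
Proof. by rewrite ![ip x _]ipC ipZl. Qed.
Lemma ip0l x : ip 0 x = 0.
Proof. by rewrite -(scale0r (0 : H)) ipZl mul0r. Qed.
Lemma ip0r x : ip x 0 = 0.
Proof. by rewrite ipC ip0l. Qed.
Lemma ip_suml (I : Type) (r : seq I) (P : pred I) (F : I -> H) y :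
  ip (\sum_(i <- r | P i) F i) y = \sum_(i <- r | P i) ip (F i) y.
Proof. by apply: (big_morph (ip^~ y)) => [u v|]; rewrite ?ipDl ?ip0l. Qed.
Lemma ip_sumr (I : Type) (r : seq I) (P : pred I) (F : I -> H) y :
  ip y (\sum_(i <- r | P i) F i) = \sum_(i <- r | P i) ip y (F i).
Proof. by rewrite ipC ip_suml; apply: eq_bigr => i _; rewrite ipC. Qed.

Lemma ipNr x y : ip x (- y) = - ip x y.
Proof. by rewrite ![ip x _]ipC ipNl. Qed.

Let ipE := (ipDl, ipDr, ipNl, ipNr, ipZl, ipZr).

(** Cauchy-Schwarz for the form of [A], with a free weight: expand [<A (s x - y), s x - y> >= 0] and
    divide by [s]. *)
Lemma ip_young (A : 'End(H)) x y s : self_adjoint A ->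
  (forall u, 0 <= ip (A u) u) -> 0 < s ->
  2 * ip (A x) y <= s * ip (A x) x + s^-1 * ip (A y) y.
Proof.
move=> sA pA s0; have := pA (s *: x - y).
rewrite linearB linearZ /= !ipE [ip (A y) x]sA [ip y (A x)]ipC => Ip.
have -> : s^-1 * ip (A y) y = (ip (A y) y) / s by rewrite mulrC.
rewrite -subr_ge0 (_ : _ - _ = (s * (s * ip (A x) x) + s * - ip (A x) y +
  (s * - ip (A x) y - - ip (A y) y)) / s); last by field; rewrite gt_eqF.
by apply: divr_ge0; [lra | exact: ltW].
Qed.

(** A self-adjoint [A] has the same kernel as its square, hence by dimension count the same range.
    So [A f = A (A g)] for some [g], which splits [f] into a kernel part and a range part. *)
Lemma self_adjoint_decomp (A : 'End(H)) f :
  self_adjoint A -> exists g, A (f - A g) = 0.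
Proof.
move=> sA; pose A2 := (A \o A)%VF.
have kerA2 : lker A2 = lker A.
  apply/vspaceP => x; rewrite !memv_ker comp_lfunE.
  apply/eqP/eqP => [AAx|->]; last by rewrite linear0.
  by apply: ip_eq0; rewrite sA AAx ip0r.
have imA2 : (limg A2 <= limg A)%VS.
  by rewrite limg_comp limgS ?subvf.
have EA2 : limg A2 = limg A.
  apply/eqP; rewrite eqEdim imA2 /=.
  have := limg_ker_dim A2 fullv; rewrite kerA2 -(limg_ker_dim A fullv).
  by move/eqP; rewrite eqn_add2l => /eqP ->.
have : A f \in limg A2 by rewrite EA2 memv_img ?memvf.
case/memv_imgP => g _ Eg; exists g.
by rewrite linearB /= Eg comp_lfunE subrr.
Qed.

(** * Two projections: from correlation of the ranges to correlation of the complements *)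

Section TwoProjections.
Variables (Q Q' Q2 : 'End(H)) (eps : R).
Hypotheses (sQ : self_adjoint Q) (sQ' : self_adjoint Q').
Hypotheses (QQ : forall x, Q (Q x) = Q x) (QQ' : forall x, Q' (Q' x) = Q' x).
Hypotheses (QQ2 : forall x, Q (Q2 x) = Q2 x) (QQ2' : forall x, Q' (Q2 x) = Q2 x).
Hypothesis Q2Q2 : forall x, Q2 (Q2 x) = Q2 x.
Hypotheses (Q2Q : forall x, Q2 (Q x) = Q2 x) (Q2Q' : forall x, Q2 (Q' x) = Q2 x).
Hypotheses (eps0 : 0 <= eps) (eps1 : eps <= 1).
Hypothesis correlation_le : forall a b, Q a = a -> Q' b = b -> Q2 a = 0 ->
  Q2 b = 0 -> 2 * ip a b <= eps * (ip a a + ip b b).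

(** Test the correlation bound on [a] and [eps^-1 *: Q' a], the scaling that yields the square of
    [eps]; for [eps = 0] test it on [a] and [Q' a]. *)
Lemma projection_contraction a : Q a = a -> Q2 a = 0 ->
  ip (Q' a) (Q' a) <= eps ^+ 2 * ip a a.
Proof.
move=> Qa Q2a; have E : ip a (Q' a) = ip (Q' a) (Q' a) by rewrite sQ' QQ'.
have [e0|en0] := eqVneq eps 0.
  have := @correlation_le a (Q' a) Qa (QQ' a) Q2a; rewrite Q2Q' e0 E expr0n mul0r.
  by move=> /(_ Q2a); rewrite mul0r; lra.
have ep : 0 < eps by rewrite lt_def en0.
have := @correlation_le a (eps^-1 *: Q' a) Qa.
rewrite !linearZ /= QQ' Q2Q' Q2a scaler0 => /(_ erefl erefl erefl).
rewrite !ipE E => h; rewrite -subr_ge0.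
rewrite (_ : _ - _ = eps * (eps * (ip a a + eps^-1 * (eps^-1 * ip (Q' a) (Q' a))) -
  2 * (eps^-1 * ip (Q' a) (Q' a)))); last by field.
by rewrite mulr_ge0 ?subr_ge0.
Qed.

(** On the range of [Q] put [M = Q Q'], which is at most [eps^2] on the kernel of [Q2] by
    [projection_contraction]. The two squared norms are the forms of [M - M^2] and [1 - M], so the
    claim is [(eps^2 - M)(1 - M) >= 0]. *)
Lemma complement_contraction a : Q a = a -> Q2 a = 0 ->
  ip (Q' a - Q (Q' a)) (Q' a - Q (Q' a)) <= eps ^+ 2 * ip (a - Q' a) (a - Q' a).
Proof.
move=> Qa Q2a; have := projection_contraction Qa Q2a.
have E : ip a (Q' a) = ip (Q' a) (Q' a) by rewrite sQ' QQ'.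
have E1 : ip (Q' a) (Q (Q' a)) = ip (Q (Q' a)) (Q (Q' a)) by rewrite [RHS]sQ QQ.
have E2 : ip a (Q (Q' a)) = ip (Q' a) (Q' a) by rewrite -sQ Qa E.
(* (eps^2 - M)(1 - M) = (eps^2 - M)^2 + (1 - eps^2)(eps^2 - M) with M = Q Q'. *)
have := ip_ge0 (eps ^+ 2 *: a - Q (Q' a)).
rewrite !ipE ![ip (Q (Q' a)) a]ipC ![ip (Q (Q' a)) (Q' a)]ipC ![ip (Q' a) a]ipC.
rewrite E E1 E2.
move: (ip a a) (ip (Q' a) (Q' a)) (ip (Q (Q' a)) (Q (Q' a))) => A B C.
have : eps ^+ 2 <= 1 by rewrite expr_le1.
move: (eps ^+ 2) => e e1 h1 h2.
have : 0 <= (1 - e) * (e * A - B) by rewrite mulr_ge0 ?subr_ge0.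
nra.
Qed.

(** After subtracting [Q2 f], write [f1 = f0 + a + b] with [f0] killed by both projections, [a] in
    the range of [Q] and [b] in that of [Q']. The complements become [f0 + u] and [f0 + v] with [f0]
    orthogonal to [u] and [v], so [f0] adds only [|f0|^2 >= 0], and [<u, v>] is controlled by
    [complement_contraction]. *)
Lemma complement_correlation f s : 0 < s ->
  - eps * (s * ip (f - Q f) (f - Q f) + s^-1 * ip (f - Q' f) (f - Q' f)) <=
  2 * ip (f - Q f) (f - Q' f).
Proof.
move=> s0; pose f1 := f - Q2 f.
have Ef : f - Q f = f1 - Q f1.
  by rewrite /f1 linearB /= QQ2 opprB addrA subrK.
have Ef' : f - Q' f = f1 - Q' f1.
  by rewrite /f1 linearB /= QQ2' opprB addrA subrK.
have sQQ : self_adjoint (Q + Q').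
  by move=> x y; rewrite !add_lfunE !ipE sQ sQ'.
have [g] := self_adjoint_decomp f1 sQQ.
rewrite !add_lfunE; pose a := Q g; pose b := Q' g; rewrite -/a -/b.
set f0 := f1 - (a + b) => Ef0.
(* The form of [Q + Q'] at [f0] is [|Q f0|^2 + |Q' f0|^2], so a vanishing sum kills both terms. *)
have [Qf0 Q'f0] : Q f0 = 0 /\ Q' f0 = 0.
  have E0 : ip (Q f0) (Q f0) + ip (Q' f0) (Q' f0) = 0.
    by rewrite [X in X + _]sQ [X in _ + X]sQ' QQ QQ' -ipDr Ef0 ip0r.
  have := ip_ge0 (Q f0); have := ip_ge0 (Q' f0) => h1 h2.
  by split; apply: ip_eq0; lra.
have Ef1 : f1 = f0 + (a + b) by rewrite /f0 subrK.
have Q2f1 : Q2 f1 = 0 by rewrite /f1 linearB /= Q2Q2 subrr.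
clearbody f0; clearbody f1.
(* [Q2] sends [a + b] to twice [Q2 g] and kills [f0]; this makes [a] and [b] admissible in the
   correlation hypothesis. *)
have Q2g : Q2 g = 0.
  move: Q2f1; rewrite Ef1 !linearD /= Q2Q Q2Q' -(Q2Q f0) Qf0 linear0 add0r -mulr2n.
  by rewrite -scaler_nat => /eqP; rewrite scaler_eq0 pnatr_eq0 => /eqP.
have Qa : Q a = a by exact: QQ.
have Q'b : Q' b = b by exact: QQ'.
have Q2a : Q2 a = 0 by rewrite Q2Q.
have Eu : f1 - Q f1 = f0 + (b - Q b).
  have -> : Q f1 = a + Q b by rewrite Ef1 !linearD /= Qf0 Qa add0r.
  by rewrite Ef1 opprD !addrA [f0 + a + b]addrAC addrK.
have Ev : f1 - Q' f1 = f0 + (a - Q' a).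
  have -> : Q' f1 = Q' a + b by rewrite Ef1 !linearD /= Q'f0 Q'b add0r.
  by rewrite Ef1 opprD !addrA [_ - Q' a]addrAC addrK.
rewrite Ef Ef' Eu Ev; pose k := Q' a.
have f0Q x : ip f0 (Q x) = 0 by rewrite -sQ Qf0 ip0l.
have f0Q' x : ip f0 (Q' x) = 0 by rewrite -sQ' Q'f0 ip0l.
have f0a : ip f0 a = 0 by exact: f0Q.
have f0b : ip f0 b = 0 by exact: f0Q'.
have contr := complement_contraction Qa Q2a; rewrite -/k in contr.
set u := b - Q b; set v := a - Q' a in contr *.
have f0u : ip f0 u = 0 by rewrite /u ipE ipNr f0b f0Q subrr.
have f0v : ip f0 v = 0 by rewrite /v ipE ipNr f0a f0Q' subrr.
have Euv : ip u v = - ip (k - Q k) u.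
  have kb : ip k b = ip a b by rewrite sQ' Q'b.
  have kQb : ip k (Q b) = ip (Q k) (Q b) by rewrite [RHS]sQ QQ.
  have Qkb : ip (Q k) b = ip (Q k) (Q b) by rewrite -sQ QQ.
  have aQb : ip a (Q b) = ip a b by rewrite -sQ Qa.
  rewrite /u /v -/k !ipE ![ip (Q b) _]ipC ![ip b _]ipC kb kQb Qkb aQb.
  ring.
clearbody u v; rewrite !ipE (ipC u f0) (ipC v f0) f0u f0v Euv.
have h0 := ip_ge0 f0; have hu := ip_ge0 u; have hv := ip_ge0 v.
set w := k - Q k in contr *.
have [e0|en0] := eqVneq eps 0.
  have w0 : w = 0.
    apply: ip_eq0; apply/eqP; rewrite eq_le ip_ge0 andbT.
    by move: contr; rewrite e0 expr0n mul0r.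
  by rewrite w0 ip0l e0; lra.
have ep : 0 < eps by rewrite lt_def en0.
have sA1 : self_adjoint \1%VF by move=> x y; rewrite !id_lfunE.
have sA2 x : 0 <= ip (\1%VF x) x by rewrite id_lfunE.
(* The weight [eps * s] turns the bound [|w|^2 <= eps^2 |v|^2] into exactly [eps / s * |v|^2]. *)
have := ip_young (A := \1%VF) u w sA1 sA2 (mulr_gt0 ep s0).
rewrite !id_lfunE [ip u w]ipC => Y.
have : (eps * s)^-1 * ip w w <= eps * s^-1 * ip v v.
  rewrite invfM mulrAC.
  rewrite (_ : eps * s^-1 * _ = (eps ^-1 * (eps ^+ 2 * ip v v)) / s); last first.
    by field; rewrite en0 gt_eqF.
  by rewrite ler_wpM2r ?invr_ge0 ?(ltW s0) // ler_wpM2l ?invr_ge0 // ltW.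
have : 0 <= eps * s * ip f0 f0 by rewrite !mulr_ge0 // ltW.
have : 0 <= eps * s^-1 * ip f0 f0 by rewrite !mulr_ge0 ?invr_ge0 // ltW.
move: Y; rewrite !addr0 !add0r; move: (s^-1) (eps * s)^-1 => s' es'.
lra.
Qed.
End TwoProjections.

(** [L^2 >= gam L] excludes spectrum strictly between 0 and [gam]. Without eigenvectors: for
    [h = L g], weighted Cauchy-Schwarz gives [2 |h|^2 <= gam <L g, g> + <L h, h> / gam], and the
    first term on the right is at most [|h|^2]. *)
Lemma spectral_gap_of_square (L : 'End(H)) gam f : self_adjoint L ->
  (forall u, 0 <= ip (L u) u) -> 0 < gam ->
  (forall u, gam * ip (L u) u <= ip (L u) (L u)) ->
  exists2 f0, L f0 = 0 & gam * ip (f - f0) (f - f0) <= ip (L f) f.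
Proof.
move=> sL pL g0 LL; have [g Lg] := self_adjoint_decomp f sL.
exists (f - L g) => //; rewrite subKr; set h := L g.
have Lfh : L f = L h by move/eqP: Lg; rewrite linearB subr_eq0 => /eqP.
have -> : ip (L f) f = ip (L h) h.
  by rewrite Lfh sL Lfh -sL.
have := ip_young g h sL pL g0; rewrite -/h; have := LL g; rewrite -/h => h1 h2.
have : ip h h <= gam^-1 * ip (L h) h by lra.
by rewrite ler_pdivlMl.
Qed.

(** Weighted Cauchy-Schwarz between [f] and [P f] gives [2 |P f|^2 <= r^2 |f|^2 + |P f|^2]. The form
    bound is assumed only at [f] and [P f] because it will be available only for functions of mean
    zero. *)
Lemma self_adjoint_contraction (P : 'End(H)) r f : self_adjoint P ->
  (forall u, 0 <= ip (P u) u) -> 0 <= r ->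
  ip (P f) f <= r * ip f f -> ip (P (P f)) (P f) <= r * ip (P f) (P f) ->
  ip (P f) (P f) <= r ^+ 2 * ip f f.
Proof.
move=> sP pP r0 h1 h2.
have [r00|rn0] := eqVneq r 0.
  have := ip_young f (P f) sP pP ltr01; move: h1 h2; rewrite r00 invr1.
  by rewrite expr0n !mul0r; lra.
have rp : 0 < r by rewrite lt_def rn0.
have := ip_young f (P f) sP pP rp.
have : r * ip (P f) f <= r * (r * ip f f) by rewrite ler_wpM2l.
have : r^-1 * ip (P (P f)) (P f) <= ip (P f) (P f) by rewrite ler_pdivrMl.
rewrite expr2; lra.
Qed.
End InnerProduct.

(** Meant for the Gram matrix of the functions [P_i f], taken in path order. With
    [s = phi j / phi i] in the adjacent bounds, [G i i] keeps the coefficient [1 - (phi (i - 1) +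
    phi (i + 1)) / (2 phi i) = 1 / phi i], and [phi] is at most [(d + 1)^2 / 4]. *)
Lemma path_form_ge (R : realFieldType) (d : nat) (G : 'I_d -> 'I_d -> R) :
  (forall i j, G i j = G j i) -> (forall i, 0 <= G i i) ->
  (forall i j : 'I_d, i.+1 = j -> forall s, 0 < s ->
     - 2^-1 * (s * G i i + s^-1 * G j j) <= 2 * G i j) ->
  (forall i j : 'I_d, (i.+1 < j)%N -> 0 <= G i j) ->
  4 / d.+1%:R ^+ 2 * \sum_i G i i <= \sum_i \sum_j G i j.
Proof.
move=> G_sym G_ge0 G_adj G_far.
(* Barta's method: [phi] is a discrete concave supersolution, with
   [phi (k + 1) + phi (k - 1) = 2 phi k - 2]. *)
pose phi (k : nat) : R := k.+1%:R * (d%:R - k%:R).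
have phi_gt0 (i : 'I_d) : 0 < phi i.
  by rewrite mulr_gt0 ?ltr0Sn // subr_gt0 ltr_nat.
pose adj (i j : 'I_d) := (j == i.+1 :> nat) || (j.+1 == i :> nat).
(* [B] distributes the lower bounds so that row [i] involves only [G i i]; it is compared with [G]
   after symmetrization. *)
pose B i j : R := (i == j)%:R * G i i - 2^-1 * ((adj i j)%:R * (phi j / phi i * G i i)).
have GB i j : B i j + B j i <= G i j + G j i.
  wlog: i j / (i <= j)%N => [hw|].
    by case: (leqP i j) => [|/ltnW]/hw //; rewrite addrC [X in _ <= X]addrC.
  rewrite leq_eqVlt => /orP[/eqP/val_inj ->|ij].
    by rewrite /B /adj eqxx (ltn_eqF (ltnSn j)) (gtn_eqF (ltnSn j)) /=; lra.
  have nij : (i == j) = false by apply/eqP => E; rewrite E ltnn in ij.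
  have adj_sym : adj j i = adj i j by rewrite /adj orbC; congr (_ || _); rewrite eq_sym.
  rewrite /B (eq_sym j i) nij adj_sym [G j i]G_sym.
  case adjij : (adj i j); last first.
    have : (i.+1 < j)%N.
      move: adjij; rewrite /adj => /norP[h _]; rewrite ltn_neqAle ij andbT.
      by rewrite eq_sym.
    by move/G_far; rewrite !mulr0n !mul0r; lra.
  have ij1 : i.+1 = j.
    by case/orP: adjij => /eqP // E; move: ij; rewrite -E ltnNge leqnSn.
  have := G_adj i j ij1 (phi j / phi i) (divr_gt0 (phi_gt0 j) (phi_gt0 i)).
  rewrite invf_div !mulr0n !mulr1n !mul0r !mul1r; lra.
have : \sum_i \sum_j B i j <= \sum_i \sum_j G i j.
  have : \sum_i \sum_j (B i j + B j i) <= \sum_i \sum_j (G i j + G j i).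
    by apply: ler_sum => i _; apply: ler_sum => j _.
  have E (F : 'I_d -> 'I_d -> R) :
      \sum_i \sum_j (F i j + F j i) = 2 * \sum_i \sum_j F i j.
    under eq_bigr => i _ do rewrite big_split /=.
    by rewrite big_split /= [X in _ + X]exchange_big /=; ring.
  by rewrite !E; lra.
apply: le_trans; rewrite mulr_sumr; apply: ler_sum => i _.
rewrite /B big_split /= (bigD1 i) //= big1 ?addr0 ?eqxx ?mul1r; last first.
  by move=> j; rewrite eq_sym => /negPf ->; rewrite mul0r.
rewrite sumrN -mulr_sumr.
have -> : \sum_j (adj i j)%:R * (phi j / phi i * G i i) =
    (\sum_j (adj i j)%:R * phi j) / phi i * G i i.
  by rewrite !mulr_suml; apply: eq_bigr => j _; rewrite !mulrA.
(* The formula also holds at the ends of the path, since [phi] vanishes at the virtual neighbours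
   [-1] and [d]. *)
have -> : \sum_j (adj i j)%:R * phi j = 2 * phi i - 2.
  have -> : \sum_j (adj i j)%:R * phi j =
      \sum_(j < d) (j == i.+1 :> nat)%:R * phi j + \sum_(j < d) (j.+1 == i :> nat)%:R * phi j.
    rewrite -big_split /=; apply: eq_bigr => j _; rewrite /adj -mulrDl; congr (_ * _).
    case: eqP => [->|_] /=; last by rewrite add0r.
    by rewrite gtn_eqF ?addr0 // ltnW.
  have -> : \sum_(j < d) (j == i.+1 :> nat)%:R * phi j = phi i.+1.
    case: (ltnP i.+1 d) => [lt_id|le_di].
      rewrite (bigD1 (Ordinal lt_id)) //= eqxx mul1r big1 ?addr0 // => j.
      by rewrite -val_eqE /= => /negPf ->; rewrite mul0r.
    rewrite big1; last first.
      by move=> j _; rewrite ltn_eqF ?mul0r // (leq_trans (ltn_ord j)).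
    have -> : i.+1 = d by apply/eqP; rewrite eqn_leq le_di ltn_ord.
    by rewrite /phi subrr mulr0.
  have -> : \sum_(j < d) (j.+1 == i :> nat)%:R * phi j = i%:R * (d%:R - i%:R + 1).
    case: i => [[|k] lt_kd] /=.
      by rewrite big1 ?mul0r // => j _; rewrite mul0r.
    rewrite (bigD1 (Ordinal (ltnW lt_kd))) //= eqxx mul1r big1 ?addr0 => [|j].
      by rewrite /phi -[k.+1%:R]natr1; ring.
    by rewrite -val_eqE /= eqSS => /negPf ->; rewrite mul0r.
  by rewrite /phi -[i.+2%:R]natr1 -[i.+1%:R]natr1; ring.
rewrite (_ : _ - _ = (phi i)^-1 * G i i); last by field; rewrite gt_eqF.
have n0 : 0 < d.+1%:R ^+ 2 / 4 :> R by rewrite divr_gt0 // exprn_gt0 // ltr0Sn.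
rewrite ler_wpM2r // -invf_div lef_pV2 ?posrE ?phi_gt0 //.
rewrite ler_pdivlMr // /phi -[i.+1%:R]natr1 -[d.+1%:R]natr1.
(* The factors [i + 1] and [d - i] of [phi i] have sum [d + 1], so AM-GM bounds their product. *)
have := sqr_ge0 (d%:R - i%:R - (i%:R + 1) : R); nra.
Qed.

(** * Conditional expectations on a finite probability space *)

Section ConditionalExpectation.
Variables (R : realFieldType) (I : finType) (w : I -> R).
Hypothesis w_gt0 : forall x, 0 < w x.
Local Notation H := {ffun I -> R^o}.
Implicit Types f g h : H.

Definition wdot (f g : H) : R := \sum_x w x * ((f x : R) * (g x : R)).

Lemma wdotC f g : wdot f g = wdot g f.
Proof. by apply: eq_bigr => x _; rewrite [f x * _]mulrC. Qed.

Lemma wdotDl f g h : wdot (f + g) h = wdot f h + wdot g h.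
Proof. by rewrite -big_split; apply: eq_bigr => x _; rewrite ffunE mulrDl mulrDr. Qed.

Lemma wdotZl a f g : wdot (a *: f) g = a * wdot f g.
Proof.
rewrite mulr_sumr; apply: eq_bigr => x _; rewrite ffunE.
by rewrite [a *: _]/(a * _) -mulrA mulrCA.
Qed.

Lemma wdot_ge0 f : 0 <= wdot f f.
Proof. by apply: sumr_ge0 => x _; rewrite mulr_ge0 ?(ltW (w_gt0 x)) // -expr2 sqr_ge0. Qed.

Lemma wdot_eq0 f : wdot f f = 0 -> f = 0.
Proof.
move=> f0; apply/ffunP => x; rewrite ffunE; apply/eqP.
have : w x * (f x * f x) == 0.
  move: f0 => /eqP; rewrite psumr_eq0 => [|y _]; last first.
    by rewrite mulr_ge0 ?(ltW (w_gt0 y)) // -expr2 sqr_ge0.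
  by move/allP/(_ x); rewrite mem_index_enum => /(_ isT).
by rewrite !mulf_eq0 (gt_eqF (w_gt0 x)) orbb.
Qed.

Section Key.
Variables (J : finType) (k : I -> J).

Definition block_mass x : R := \sum_(y | k y == k x) w y.

Lemma block_mass_gt0 x : 0 < block_mass x.
Proof.
rewrite /block_mass (bigD1 x) //=.
by rewrite ltr_wpDr // sumr_ge0 // => y _; rewrite ltW.
Qed.

Definition condexp_fun (f : H) : H :=
  [ffun x => (\sum_(y | k y == k x) w y * f y) / block_mass x].

Lemma condexp_fun_linear : linear condexp_fun.
Proof.
move=> a f g; have sc (u : R^o) : a *: u = (a : R) * (u : R) by [].
apply/ffunP => x; rewrite !ffunE sc mulrA -mulrDl; congr (_ / _).
rewrite mulr_sumr -big_split /=; apply: eq_bigr => y _; rewrite !ffunE.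
by rewrite sc mulrDr mulrCA.
Qed.

HB.instance Definition _ := GRing.isLinear.Build R H H *:%R condexp_fun condexp_fun_linear.

Definition condexp : 'End(H) := linfun condexp_fun.

Lemma condexpE f x :
  condexp f x = (\sum_(y | k y == k x) w y * f y) / block_mass x.
Proof. by rewrite /condexp lfunE /= ffunE. Qed.

Lemma condexp_measurable f x y : k x = k y -> condexp f x = condexp f y.
Proof. by move=> kxy; rewrite !condexpE /block_mass kxy. Qed.

Lemma condexp_id f : (forall x y, k x = k y -> f x = f y) -> condexp f = f.
Proof.
move=> kf; apply/ffunP => x; rewrite condexpE.
under eq_bigr => y /eqP/kf -> do [].
by rewrite -mulr_suml -/(block_mass x) mulrC mulKf // gt_eqF ?block_mass_gt0.
Qed.

(** As a double sum the form has kernel [w x * w y / block_mass x] on pairs in a common block, which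
    is symmetric because such pairs share their block mass. *)
Lemma condexp_self_adjoint f g : wdot (condexp f) g = wdot f (condexp g).
Proof.
have E (u v : H) : wdot (condexp u) v =
    \sum_x \sum_y if k y == k x then w y * u y * (w x * v x / block_mass x) else 0.
  apply: eq_bigr => x _; rewrite condexpE -big_mkcond -mulr_suml /=.
  have r (a b c e : R) : a * (b / c * e) = b * (a * e / c) by ring.
  exact: r.
rewrite [RHS]wdotC !E [RHS]exchange_big.
apply: eq_bigr => x _; apply: eq_bigr => y _; rewrite eq_sym.
case: eqP => // kxy; rewrite [in RHS]/block_mass -kxy -/(block_mass x).
have r (a b c e z : R) : a * b * (c * e / z) = c * e * (a * b / z) by ring.
exact: r.
Qed.

Lemma condexp_block_sum f x : condexp f = 0 -> \sum_(y | k y == k x) w y * f y = 0.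
Proof.
move/ffunP/(_ x); rewrite condexpE ffunE => /eqP.
by rewrite mulf_eq0 invr_eq0 (gt_eqF (block_mass_gt0 x)) orbF => /eqP.
Qed.

Lemma ler_sum_blocks (F G : I -> R) :
  (forall x, \sum_(y | k y == k x) F y <= \sum_(y | k y == k x) G y) ->
  \sum_x F x <= \sum_x G x.
Proof.
move=> FG; rewrite (partition_big k xpredT) //= [leRHS](partition_big k xpredT) //=.
apply: ler_sum => j _.
have [x /eqP kx|k0] := pickP [pred x | k x == j]; first by rewrite -kx.
by rewrite !big_pred0.
Qed.

End Key.

Section Tower.
Variables (J J' : finType) (k : I -> J) (k' : I -> J').
Hypothesis kk' : forall x y, k x = k y -> k' x = k' y.

Lemma condexp_tower f : condexp k (condexp k' f) = condexp k' f.
Proof. by apply: condexp_id => x y /kk'; exact: condexp_measurable. Qed.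

(** This is the adjoint of [condexp_tower], both expectations being self-adjoint; it is tested
    against the difference of the two sides. *)
Lemma condexp_tower' f : condexp k' (condexp k f) = condexp k' f.
Proof.
apply/eqP; rewrite -subr_eq0; apply/eqP/wdot_eq0; set g := _ - _.
have E : wdot (condexp k' (condexp k f)) g = wdot (condexp k' f) g.
  by rewrite !condexp_self_adjoint condexp_tower.
by rewrite {1}/g wdotDl E -scaleN1r wdotZl; ring.
Qed.
End Tower.

End ConditionalExpectation.

(** * Facets and links of codimension 2 *)

Section Complex.
Variables (R : realType) (V : finType) (X : {set {set V}}) (d : nat).
Variables (T : 'I_d -> {set V}) (mu : {set V} -> R).
Hypothesis X_complex : simplicial_complex X.
Hypothesis X_pure : pure X d.
Hypothesis X_partite : partite X T.
Hypothesis mu_dist : facet_distribution X d mu.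

Local Notation facet := {x : {set V} | x \in faces X d}.
Implicit Types (x y z : facet) (i j : 'I_d) (t : {set V}).

Lemma facet_in x : val x \in X.
Proof. by have := valP x; rewrite inE => /andP[]. Qed.

Lemma card_facet x : #|val x| = d.
Proof. by have := valP x; rewrite inE => /andP[_ /eqP]. Qed.

Lemma face_in_facet t : t \in X -> exists x, t \subset val x.
Proof.
move=> tX; have [s smax ts] := @maxset_exists _ (fun s => s \in X) t tX.
have sX : s \in X by case/maxsetP: smax.
have sF : s \in faces X d by rewrite inE sX; apply/eqP/X_pure.
by exists (exist _ s sF).
Qed.

Lemma facet_maximal x : is_facet X (val x).
Proof.
apply/maxsetP; split; first exact: facet_in.
move=> s sX xs; have [y sy] := face_in_facet sX.
apply/eqP; rewrite eq_sym eqEcard xs card_facet -(card_facet y).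
exact: subset_leq_card.
Qed.

Lemma part_disjoint i j v : v \in T i -> v \in T j -> i = j.
Proof.
move=> vi vj; apply/eqP; apply: contraT => ij.
have [_ /(_ i j ij) dij _] := X_partite.
by have := disjointFr dij vi; rewrite vj.
Qed.

Lemma facet_part x v : v \in val x -> exists i, v \in T i.
Proof.
move=> vx; have [h _ _] := X_partite; apply/h; rewrite inE.
by apply: X_complex (facet_in x) _; rewrite sub1set.
Qed.

Lemma facet_selector : exists sel : 'I_d -> facet -> V,
  forall i x, val x :&: T i = [set sel i x].
Proof.
apply: (@fin_all_exists _ (fun=> facet -> V)
  (fun i s => forall x, val x :&: T i = [set s x])) => i.
apply: (@fin_all_exists _ (fun=> V) (fun x v => val x :&: T i = [set v])) => x.
have [_ _ h] := X_partite; have /eqP/cards1P[v Ev] := h _ (facet_maximal x) i.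
by exists v.
Qed.

(** Facets with the same key for [T i] agree outside part [i], so conditioning on this key resamples
    that part. For the union of two distinct parts the key is the face of codimension 2 whose link
    carries both. *)
Definition key (B : {set V}) x : {set V} := val x :\: B.

Lemma replaces_key i x y : replaces T i (val x) (val y) = (key (T i) y == key (T i) x).
Proof.
apply/existsP/eqP => [[F /andP[Fi /eqP Ey]]|kxy].
  rewrite /key Ey; apply/setP => v; rewrite !inE.
  by case: eqP => [->|_] /=; rewrite ?Fi // andbA andbb.
have [_ _ h] := X_partite; have /eqP/cards1P[F EF] := h _ (facet_maximal y) i.
have : F \in val y :&: T i by rewrite EF inE.
rewrite inE => /andP[_ Fi]; exists F; rewrite Fi /=; apply/eqP.
by rewrite -/(key _ _) -kxy -EF setID.
Qed.

Lemma key_setU B B' x y : key B x = key B y -> key (B :|: B') x = key (B :|: B') y.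
Proof. by rewrite /key -!setDDl => ->. Qed.

Lemma key_setU' B B' x y : key B' x = key B' y -> key (B :|: B') x = key (B :|: B') y.
Proof. by rewrite setUC; exact: key_setU. Qed.

(** * Connected links: functions invariant under every resampling are constant *)

Section Connected.
Hypothesis X_connected : connected_complex X d.
Variable f : facet -> R.
Hypothesis f_key : forall i x y, key (T i) x = key (T i) y -> f x = f y.

(** Each of the two facets adds one vertex to [t], and both vertices lie in the same part because
    every facet meets every part; so the facets share a key. *)
Lemma facet_ridge t x y : t \in X -> codim d t = 1%N ->
  t \subset val x -> t \subset val y -> f x = f y.
Proof.
move=> tX ct tx ty.
have card_diff z : t \subset val z -> #|val z :\: t| = 1%N.
  by move=> tz; rewrite cardsDS // card_facet.
have /eqP/cards1P[a Ea] := card_diff x tx.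
have /eqP/cards1P[b Eb] := card_diff y ty.
have ax : a \in val x :\: t by rewrite Ea inE.
have by_ : b \in val y :\: t by rewrite Eb inE.
move: ax by_; rewrite !inE => /andP[at_ ax] /andP[bt by_].
have [i ai] := facet_part ax; have [j bj] := facet_part by_.
have [sel selP] := facet_selector.
(* Otherwise the vertex of [x] in part [j] lies in [t], hence in [y], and must equal [b], which is
   outside [t]. *)
have ij : i = j.
  apply/eqP; apply: contraT => ij.
  have selx : sel j x \in val x :&: T j by rewrite selP inE.
  move: selx; rewrite inE => /andP[cx cj].
  have ct' : sel j x \in t.
    apply: contraT => cnt; have : sel j x \in val x :\: t by rewrite inE cnt.
    rewrite Ea inE => /eqP E; rewrite E in cj.
    by move: ij; rewrite (part_disjoint ai cj) eqxx.
  have cy : sel j x \in val y :&: T j by rewrite inE cj (subsetP ty).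
  have : b \in val y :&: T j by rewrite inE by_.
  move: cy; rewrite selP !inE => /eqP E1 /eqP E2.
  by move: bt; rewrite E2 -E1 ct'.
apply: (f_key (i := i)).
have E z v : t \subset val z -> val z :\: t = [set v] -> v \in T i ->
    key (T i) z = t :\: T i.
  move=> tz Ez vi; apply/setP => u; rewrite !inE.
  case ui : (u \in T i) => //=; apply/idP/idP; last exact: (subsetP tz).
  move=> uz; apply: contraT => ut; have : u \in val z :\: t by rewrite inE ut.
  by rewrite Ez inE => /eqP E; rewrite E vi in ui.
by rewrite (E x a) // (E y b) // ij.
Qed.

(** Induction on the codimension: [f] is already constant on the facets above [v |: t]. Each edge of
    a path in the link of [t] lies in a facet, which joins the constants of its two end points. *)
Lemma facet_connected t x y : t \in X -> t \subset val x -> t \subset val y -> f x = f y.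
Proof.
move Ek : (codim d t) => k; elim: k t x y Ek => [|k IHk] t x y ct tX tx ty.
  have dt : (d <= #|t|)%N by rewrite -subn_eq0; apply/eqP.
  have E z : t \subset val z -> val z = t.
    by move=> tz; apply/eqP; rewrite eq_sym eqEcard tz card_facet.
  by congr f; apply: val_inj; rewrite (E x) // (E y).
case: k IHk ct => [|k] IHk ct; first exact: (facet_ridge tX ct).
have lt_td : (#|t| < d)%N by rewrite -subn_gt0 -/(codim d t) ct.
have ex z : t \subset val z -> exists2 v, v \in val z & v \notin t.
  move=> tz; have : (0 < #|val z :\: t|)%N by rewrite cardsDS // card_facet subn_gt0.
  by case/card_gt0P => v; rewrite inE => /andP[? ?]; exists v.
have sub z v : t \subset val z -> v \in val z -> v |: t \subset val z.
  by move=> tz vz; rewrite subUset sub1set vz.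
have inX z v : t \subset val z -> v \in val z -> v |: t \in X.
  by move=> tz vz; apply: X_complex (facet_in z) (sub _ _ tz vz).
have vert z v : t \subset val z -> v \in val z -> v \notin t -> v \in vertices (link X t).
  move=> tz vz vt; rewrite inE; apply/imsetP; exists (v |: t).
    by rewrite inE (inX z) // subsetUr.
  apply/setP => u; rewrite !inE; case: eqP => [->|_] /=; first by rewrite vt.
  by case: (u \in t).
have step v y1 y2 : v \notin t -> v |: t \subset val y1 ->
    v |: t \subset val y2 -> f y1 = f y2.
  move=> vt v1 v2; apply: (IHk (v |: t)) => //.
    rewrite /codim cardsU1 vt add1n subnS.
    by move: ct; rewrite /codim => ->.
  exact: X_complex (facet_in y1) v1.
have [a ax at_] := ex x tx; have [b by_ bt] := ex y ty.
have codim2 : (1 < codim d t)%N by rewrite ct.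
have := X_connected tX codim2 (vert _ _ tx ax at_) (vert _ _ ty by_ bt).
(* The induction along the path carries the current vertex together with a facet above [t]
   containing it. *)
case/connectP => p; elim: p a x tx ax at_ => [|c p IHp] a x tx ax at_ /=.
  by move=> _ ba; apply: (step a) => //; [exact: sub | rewrite -ba; exact: sub].
case/andP => ac pc bl.
move: ac; rewrite /link_edge inE => /andP[/imsetP[s]].
rewrite inE => /andP[sX ts] Es _.
have [z sz] := face_in_facet sX.
have acs : (a \in s) && (c \in s) && (c \notin t).
  have : a \in s :\: t by rewrite -Es !inE eqxx.
  have : c \in s :\: t by rewrite -Es !inE eqxx orbT.
  by rewrite !inE => /andP[-> ->] /andP[_ ->].
case/andP: acs => /andP[as_ cs] ct'.
have tz : t \subset val z by exact: subset_trans ts sz.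
rewrite (step a x z) //; [|exact: sub|by apply: sub => //; exact: (subsetP sz)].
by apply: (IHp c z) => //; exact: (subsetP sz).
Qed.

Lemma facet_constant x y : f x = f y.
Proof.
apply: (@facet_connected set0); rewrite ?sub0set //.
by apply: X_complex (facet_in x) _; rewrite sub0set.
Qed.

End Connected.

Variable sel : 'I_d -> facet -> V.
Hypothesis selP : forall i x, val x :&: T i = [set sel i x].

Lemma sel_in i x : sel i x \in val x.
Proof. by have := set11 (sel i x); rewrite -selP inE => /andP[]. Qed.

Lemma sel_part i x : sel i x \in T i.
Proof. by have := set11 (sel i x); rewrite -selP inE => /andP[]. Qed.

Lemma sel_uniq i x v : v \in val x -> v \in T i -> v = sel i x.
Proof.
by move=> vx vi; apply/set1P; rewrite -selP inE vx.
Qed.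

Lemma sel_inj i j x : sel i x = sel j x -> i = j.
Proof.
move=> E; apply: (@part_disjoint i j (sel i x)); first exact: sel_part.
by rewrite E sel_part.
Qed.

Lemma mu_gt0 x : 0 < mu (val x).
Proof. by case: mu_dist => h _; apply: h; exact: valP. Qed.

Lemma probE (A : pred {set V}) : prob X d mu A = \sum_(y : facet | A (val y)) mu (val y).
Proof. by rewrite /prob (big_sub_cond (mem (faces X d)) A). Qed.

Lemma sum_pair (A : {set V}) p q (F : V -> R) : p \in A -> q \in A -> p != q ->
  (forall u, u != p -> u != q -> F u = 0) -> \sum_(u in A) F u = F p + F q.
Proof.
move=> pA qA pq F0; rewrite (bigD1 p) //= (bigD1 q) /=; last by rewrite qA eq_sym.
by rewrite big1 ?addr0 // => u /andP[/andP[_ up] uq]; exact: F0.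
Qed.

(** * Correlations inside the link of a face of codimension 2 *)

Section TopLink.
Variables (i j : 'I_d) (x0 : facet).
Hypothesis ij : i != j.
Local Notation B := (T i :|: T j).
Local Notation t := (key B x0).
Local Notation A := (vertices (link X t)).
Local Notation Z := (\sum_(y : facet | t \subset val y) mu (val y)).

Lemma facet_block y : val y :&: B = [set sel i y; sel j y].
Proof. by rewrite setIUr !selP. Qed.

Lemma sel_neq y : sel i y != sel j y.
Proof. by apply: contra ij => /eqP/sel_inj ->. Qed.

Lemma card_key y : (2 + #|key B y|)%N = d.
Proof. by rewrite -[RHS](card_facet y) -(cardsID B (val y)) facet_block cards2 sel_neq. Qed.

Lemma key_subset y : (key B y == t) = (t \subset val y).
Proof.
apply/eqP/idP => [<-|ty]; first exact: subsetDl.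
apply/eqP; rewrite eq_sym eqEcard; apply/andP; split.
  apply/fintype.subsetP => v vt; move: (vt); rewrite !inE => /andP[-> _] /=.
  exact: (fintype.subsetP ty).
by rewrite -(leq_add2l 2) !card_key.
Qed.

Lemma facet_diff y : t \subset val y -> val y :\: t = [set sel i y; sel j y].
Proof.
rewrite -key_subset => /eqP <-; rewrite -facet_block; apply/setP => v.
by rewrite !inE; case: (v \in val y); rewrite ?andbF // !andbT negbK.
Qed.

Lemma key_face : t \in X.
Proof. by apply: X_complex (facet_in x0) (subsetDl _ _). Qed.

Lemma codim_key : codim d t = 2.
Proof. by rewrite /codim -(card_key x0) addnK. Qed.

Lemma block_mass_key_gt0 : 0 < Z.
Proof.
rewrite (bigD1 x0) ?subsetDl //= ltr_wpDr ?mu_gt0 // sumr_ge0 // => y _.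
by rewrite ltW ?mu_gt0.
Qed.

(** This makes the weight a sum over facets, so that sums over pairs of vertices can be exchanged
    with sums over facets. For a non-edge every term vanishes, since a facet above [t] containing
    two distinct vertices outside [t] would make them an edge. *)
Lemma link_weightE u v : link_weight X d mu t u v =
  Z^-1 * \sum_(y : facet | t \subset val y)
    mu (val y) * [&& u != v, u \in val y :\: t & v \in val y :\: t]%:R.
Proof.
rewrite /link_weight; case: ifPn => [uv|nuv]; last first.
  rewrite [X in _ * X]big1 ?mulr0 // => y ty.
  case: and3P => [[uv uy vy]|_]; last by rewrite mulr0.
  case/negP: nuv; rewrite /link_edge inE cards2 uv eqxx andbT.
  apply/imsetP; exists (val y); first by rewrite inE facet_in ty.
  apply/eqP; rewrite eqEcard subUset !sub1set uy vy cards2 uv /=.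
  by rewrite facet_diff // cards2 sel_neq.
rewrite /cprob !probE mulrC; congr (_ * _).
move: uv; rewrite /link_edge inE cards2 => /andP[/imsetP[s _ Es]] uv2.
have uv : u != v by move: uv2; case: (u != v).
have ut : u \notin t.
  have : u \in s :\: t by rewrite -Es !inE eqxx.
  by rewrite in_setD => /andP[].
have vt : v \notin t.
  have : v \in s :\: t by rewrite -Es !inE eqxx orbT.
  by rewrite in_setD => /andP[].
rewrite [RHS]big_mkcond /= [LHS]big_mkcond /=; apply: eq_bigr => y _.
rewrite ![_ \in _ :\: t]in_setD uv ut vt /=.
by case: (t \subset val y); case: (u \in val y); case: (v \in val y); rewrite ?mulr1 ?mulr0.
Qed.

Lemma link_vertex y v : t \subset val y -> v \in val y :\: t -> v \in A.
Proof.
move=> ty; rewrite in_setD => /andP[vt vy]; rewrite inE; apply/imsetP; exists (v |: t).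
  rewrite inE subsetUr andbT; apply: X_complex (facet_in y) _.
  by rewrite subUset sub1set vy.
apply/setP => u; rewrite in_set1 in_setD in_setU1.
by case: eqP => [->|_] /=; rewrite ?vt ?andNb.
Qed.

(** A facet above [t] adds exactly two vertices, one in part [i] and one in part [j], and so
    contributes one edge in its two orientations. *)
Lemma link_sum (h : V -> V -> R) :
  \sum_(u in A) \sum_(v in A) link_weight X d mu t u v * h u v =
  Z^-1 * \sum_(y : facet | t \subset val y)
    mu (val y) * (h (sel i y) (sel j y) + h (sel j y) (sel i y)).
Proof.
pose b y u v := [&& u != v, u \in val y :\: t & v \in val y :\: t].
transitivity (\sum_(y : facet | t \subset val y) \sum_(u in A) \sum_(v in A)
    Z^-1 * mu (val y) * ((b y u v)%:R * h u v)).
  rewrite [RHS]exchange_big /=; apply: eq_bigr => u _.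
  rewrite [RHS]exchange_big /=; apply: eq_bigr => v _.
  rewrite link_weightE -mulrA mulr_suml mulr_sumr; apply: eq_bigr => y _.
  by rewrite -!mulrA.
rewrite mulr_sumr; apply: eq_bigr => y ty.
have pA : sel i y \in A by apply: (link_vertex ty); rewrite facet_diff // !inE eqxx.
have qA : sel j y \in A by apply: (link_vertex ty); rewrite facet_diff // !inE eqxx orbT.
have pq := sel_neq y.
under eq_bigr => u _ do rewrite -mulr_sumr.
rewrite -mulr_sumr -mulrA; congr (_ * (_ * _)).
have bE u v : b y u v =
    [&& u != v, u \in [set sel i y; sel j y] & v \in [set sel i y; sel j y]].
  by rewrite /b facet_diff.
rewrite (sum_pair pA qA pq); last first.
  move=> u up uq; rewrite big1 // => v _.
  by rewrite bE !inE (negPf up) (negPf uq) andbF mul0r.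
have b0 u v : v != sel i y -> v != sel j y -> (b y u v)%:R * h u v = 0.
  by move=> vp vq; rewrite bE !inE (negPf vp) (negPf vq) !andbF mul0r.
rewrite !(sum_pair pA qA pq); try by move=> v; exact: b0.
have qp : sel j y != sel i y by rewrite eq_sym.
by rewrite !bE !inE !eqxx pq qp /= ?orbT !mul0r !mul1r add0r addr0.
Qed.

Lemma link_weight_sym u v : link_weight X d mu t u v = link_weight X d mu t v u.
Proof.
rewrite !link_weightE; congr (_ * _); apply: eq_bigr => y _.
by rewrite eq_sym [X in _ && X]andbC.
Qed.

Lemma link_degree_gt0 u : u \in A -> 0 < \sum_(v in A) link_weight X d mu t u v.
Proof.
move=> uA; have := link_sum (fun a _ => (a == u)%:R); rewrite (bigD1 u) //=.
rewrite [X in _ + X]big1 ?addr0 => [|v /andP[_ /negPf vu]]; last first.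
  by rewrite big1 // => a _; rewrite vu mulr0.
under eq_bigr => v _ do rewrite eqxx mulr1.
move=> ->; apply: mulr_gt0; first by rewrite invr_gt0 block_mass_key_gt0.
move: uA; rewrite inE => /imsetP[s]; rewrite inE => /andP[sX ts] Es.
have [y sy] := face_in_facet sX.
have ty : t \subset val y by exact: subset_trans ts sy.
have uy : u \in val y :\: t.
  have : u \in s :\: t by rewrite -Es inE.
  by rewrite !in_setD => /andP[-> /(fintype.subsetP sy)].
rewrite (bigD1 y) //= ltr_wpDr //.
  by apply: sumr_ge0 => z _; rewrite mulr_ge0 ?(ltW (mu_gt0 z)) // -natrD ler0n.
rewrite mulr_gt0 ?mu_gt0 //; move: uy; rewrite facet_diff // !inE.
by rewrite -natrD ltr0n addn_gt0 !lt0b ![u == _]eq_sym.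
Qed.

Lemma key_partl y : t \subset val y -> key (T i) y = sel j y |: t.
Proof.
rewrite -key_subset => /eqP <-; apply/setP => v; rewrite !inE negb_or.
have [->|vj] := eqVneq v (sel j y).
  rewrite sel_in andbT; apply/negP => vi; case/eqP: ij.
  exact: part_disjoint vi (sel_part _ _).
case vy : (v \in val y); rewrite ?andbF // !andbT /=.
case vTj : (v \in T j); rewrite ?andbT //.
by move: vj; rewrite (sel_uniq vy vTj) eqxx.
Qed.

Lemma key_partr y : t \subset val y -> key (T j) y = sel i y |: t.
Proof.
rewrite -key_subset => /eqP <-; apply/setP => v; rewrite !inE negb_or.
have [->|vj] := eqVneq v (sel i y).
  rewrite sel_in andbT; apply/negP => vi; case/eqP: ij.
  exact: part_disjoint (sel_part _ _) vi.
case vy : (v \in val y); rewrite ?andbF // !andbT /=.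
case vTi : (v \in T i) => //=.
by move: vj; rewrite (sel_uniq vy vTi) eqxx.
Qed.

Lemma block_extend (m : 'I_d) (a : facet -> R) :
  (forall y z, t \subset val y -> t \subset val z -> sel m y = sel m z -> a y = a z) ->
  exists g : V -> R, forall y, t \subset val y -> g (sel m y) = a y.
Proof.
move=> am; exists (fun v =>
  (* The value is read from any facet through [v], the choice being immaterial by [am]; 0 is a
     default for vertices in no facet above [t]. *)
  if [pick z : facet | (t \subset val z) && (v \in val z)] is Some z then a z else 0).
move=> y ty; case: pickP => [z /andP[tz vz]|/(_ y)]; last by rewrite ty sel_in.
by apply: am => //; rewrite -(sel_uniq vz (sel_part _ _)).
Qed.

Variables (a b : facet -> R).
Hypothesis a_key : forall y z, key (T i) y = key (T i) z -> a y = a z.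
Hypothesis b_key : forall y z, key (T j) y = key (T j) z -> b y = b z.
Hypothesis a_mean : \sum_(y : facet | t \subset val y) mu (val y) * a y = 0.
Hypothesis b_mean : \sum_(y : facet | t \subset val y) mu (val y) * b y = 0.

(** The indices cross: once [t] is fixed, a function ignoring part [i] depends only on the vertex in
    part [j]. *)
Lemma block_extendl : exists ga : V -> R, forall y, t \subset val y -> ga (sel j y) = a y.
Proof.
by apply: block_extend => y z ty tz E; apply: a_key; rewrite !key_partl // E.
Qed.

Lemma block_extendr : exists gb : V -> R, forall y, t \subset val y -> gb (sel i y) = b y.
Proof.
by apply: block_extend => y z ty tz E; apply: b_key; rewrite !key_partr // E.
Qed.

(** Glue [a], living on part [j], and [b], living on part [i], into one function [g] on the link.
    Its degree-weighted mean vanishes, and its quadratic form and norm are, up to the common factor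
    [1 / Z], the sums of [2 a b] and of [a^2 + b^2]; so the eigenvalue bound is the claim. *)
Lemma expander_block_correlation : top_link_expander X d mu (1 / 2) ->
  2 * \sum_(y : facet | t \subset val y) mu (val y) * (a y * b y) <=
  2^-1 * (\sum_(y : facet | t \subset val y) mu (val y) * (a y * a y) +
          \sum_(y : facet | t \subset val y) mu (val y) * (b y * b y)).
Proof.
move=> /(_ t key_face codim_key) lam2.
have [ga gaE] := block_extendl; have [gb gbE] := block_extendr.
pose g v := if v \in T j then ga v else gb v.
have gj y : t \subset val y -> g (sel j y) = a y by move=> ty; rewrite /g sel_part gaE.
have gi y : t \subset val y -> g (sel i y) = b y.
  move=> ty; rewrite /g gbE // ifN //; apply/negP => vj; case/eqP: ij.
  exact: part_disjoint (sel_part _ _) vj.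
pose W : 'M[R]_#|A| := \matrix_(u, v) link_weight X d mu t (enum_val u) (enum_val v).
pose deg (u : 'I_#|A|) := \sum_(v in A) link_weight X d mu t (enum_val u) v.
have W_sym : W^T = W by apply/matrixP => u v; rewrite !mxE link_weight_sym.
have W_deg u : deg u = \sum_v W u v.
  by rewrite /deg big_enum_val; apply: eq_bigr => v _; rewrite mxE.
have deg0 u : 0 < deg u by apply: link_degree_gt0; exact: enum_valP.
have WP u v : link_walk X d mu t u v = W u v / deg u by rewrite !mxE.
have half1 : 1 / 2 < 1 :> R by lra.
have degE (k : V -> R) : \sum_u deg u * k (enum_val u) =
    Z^-1 * \sum_(y : facet | t \subset val y) mu (val y) * (k (sel i y) + k (sel j y)).
  rewrite -(link_sum (fun u _ => k u)) [RHS]big_enum_val; apply: eq_bigr => u _.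
  by rewrite /deg mulr_suml.
have g0 : \sum_u deg u * g (enum_val u) = 0.
  rewrite degE.
  have -> : \sum_(y : facet | t \subset val y) mu (val y) * (g (sel i y) + g (sel j y)) =
      \sum_(y : facet | t \subset val y) mu (val y) * b y +
      \sum_(y : facet | t \subset val y) mu (val y) * a y.
    by rewrite -big_split /=; apply: eq_bigr => y ty; rewrite gi // gj // mulrDr.
  by rewrite a_mean b_mean addr0 mulr0.
have := reversible_lambda2_le W_sym W_deg deg0 WP half1 lam2 g0.
have -> : \sum_u \sum_v W u v * (g (enum_val u) * g (enum_val v)) =
    Z^-1 * (2 * \sum_(y : facet | t \subset val y) mu (val y) * (a y * b y)).
  transitivity (\sum_(u in A) \sum_(v in A) link_weight X d mu t u v * (g u * g v)).
    rewrite [RHS]big_enum_val; apply: eq_bigr => u _.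
    by rewrite [RHS]big_enum_val; apply: eq_bigr => v _; rewrite mxE.
  rewrite (link_sum (fun u v => g u * g v)); congr (_ * _); rewrite mulr_sumr.
  by apply: eq_bigr => y ty; rewrite gi // gj //; ring.
rewrite (degE (fun v => g v ^+ 2)).
have -> : \sum_(y : facet | t \subset val y) mu (val y) * (g (sel i y) ^+ 2 + g (sel j y) ^+ 2)
  = \sum_(y : facet | t \subset val y) mu (val y) * (a y * a y) +
    \sum_(y : facet | t \subset val y) mu (val y) * (b y * b y).
  by rewrite -big_split; apply: eq_bigr => y ty; rewrite gi // gj //=; ring.
have Z0 := block_mass_key_gt0.
by rewrite [leRHS]mulrCA ler_pM2l ?invr_gt0 // mul1r.
Qed.

(** Expanding over the vertices in the two parts expresses the mean of [a b] by joint probabilities;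
    these factor, and so the mean of [a], which is zero, splits off. *)
Lemma independent_block_correlation :
  (forall F K, F \in T i -> K \in T j ->
     cprob X d mu (fun s => (F \in s) && (K \in s)) t =
     cprob X d mu (fun s => F \in s) t * cprob X d mu (fun s => K \in s) t) ->
  \sum_(y : facet | t \subset val y) mu (val y) * (a y * b y) = 0.
Proof.
move=> indep.
have [ga gaE] := block_extendl; have [gb gbE] := block_extendr.
have Z0 := block_mass_key_gt0.
have cprobE (Q : pred {set V}) : cprob X d mu Q t =
    Z^-1 * \sum_(y : facet | t \subset val y) mu (val y) * (Q (val y))%:R.
  rewrite /cprob !probE mulrC; congr (_ * _).
  rewrite [LHS]big_mkcond [RHS]big_mkcond /=; apply: eq_bigr => y _.
  by case: (t \subset val y); case: (Q (val y)); rewrite ?mulr1 ?mulr0.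
have sum_sel (m : 'I_d) (h : V -> R) y :
    \sum_(F in T m) (F \in val y)%:R * h F = h (sel m y).
  rewrite (bigD1 (sel m y)) ?sel_part //= sel_in mul1r big1 ?addr0 //.
  move=> F /andP[Fm Fs]; case Fy : (F \in val y); rewrite ?mul0r //.
  by case/eqP: Fs; exact: sel_uniq.
have mean (m : 'I_d) (h : V -> R) :
    \sum_(F in T m) cprob X d mu (fun s => F \in s) t * h F =
    Z^-1 * \sum_(y : facet | t \subset val y) mu (val y) * h (sel m y).
  under [in LHS]eq_bigr => F _ do rewrite cprobE -mulrA mulr_suml.
  rewrite -mulr_sumr exchange_big /=; congr (_ * _); apply: eq_bigr => y _.
  by rewrite -sum_sel mulr_sumr; apply: eq_bigr => F _; rewrite mulrA.
have E : \sum_(F in T i) \sum_(K in T j)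
    cprob X d mu (fun s => (F \in s) && (K \in s)) t * (gb F * ga K) =
    Z^-1 * \sum_(y : facet | t \subset val y) mu (val y) * (a y * b y).
  under eq_bigr => F _ do under eq_bigr => K _ do rewrite cprobE -mulrA mulr_suml.
  under eq_bigr => F _ do rewrite -mulr_sumr.
  rewrite -mulr_sumr; congr (_ * _).
  under eq_bigr => F _ do rewrite exchange_big /=.
  rewrite exchange_big /=; apply: eq_bigr => y ty.
  rewrite -(gaE y ty) -(gbE y ty) -(sum_sel j) -(sum_sel i) mulrC.
  rewrite [X in _ = X * _]mulrC big_distrlr /= mulr_suml; apply: eq_bigr => F _.
  rewrite mulr_suml; apply: eq_bigr => K _.
  by rewrite -mulnb natrM; ring.
have : \sum_(F in T i) \sum_(K in T j)
    cprob X d mu (fun s => (F \in s) && (K \in s)) t * (gb F * ga K) = 0.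
  under eq_bigr => F Fi do under eq_bigr => K Kj do rewrite indep // mulrACA.
  rewrite -big_distrlr /= [X in _ * X]mean.
  have -> : \sum_(y : facet | t \subset val y) mu (val y) * ga (sel j y) =
      \sum_(y : facet | t \subset val y) mu (val y) * a y.
    by apply: eq_bigr => y ty; rewrite gaE.
  by rewrite a_mean !mulr0.
rewrite E => /eqP; rewrite mulf_eq0 invr_eq0 gt_eqF //= => /eqP //.
Qed.

End TopLink.

End Complex.

(** * The down-up walk *)

Section Walk.
Variables (R : realType) (V : finType) (X : {set {set V}}) (d : nat).
Variables (T : 'I_d -> {set V}) (mu : {set V} -> R).
Hypothesis d_gt0 : (0 < d)%N.
Hypothesis X_complex : simplicial_complex X.
Hypothesis X_pure : pure X d.
Hypothesis X_partite : partite X T.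
Hypothesis mu_dist : facet_distribution X d mu.

Local Notation facet := {x : {set V} | x \in faces X d}.
Local Notation H := {ffun facet -> R^o}.
Local Notation w := (fun x : facet => mu (val x)).
Local Notation dot := (wdot w).
Let w_gt0 : forall x : facet, 0 < w x := mu_gt0 mu_dist.

Definition resample (i : 'I_d) : 'End(H) := condexp w (key (T i)).
Local Notation Q := resample.
(** For [i != j] its kernel consists of the functions with mean zero above every face that omits
    exactly the parts [i] and [j], the setting of the bounds inside links. *)
Definition resample2 (i j : 'I_d) : 'End(H) := condexp w (key (T i :|: T j)).

Lemma resample_self_adjoint i : self_adjoint dot (Q i).
Proof. by move=> f g; exact: condexp_self_adjoint. Qed.

Lemma resample_idem i f : Q i (Q i f) = Q i f.
Proof. exact: condexp_tower. Qed.

Lemma resample_fixed i (f : H) x y : Q i f = f -> key (T i) x = key (T i) y -> f x = f y.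
Proof. by move=> <-; exact: condexp_measurable. Qed.

Lemma resample_correlation i j (f : H) (eps s : R) : 0 <= eps -> eps <= 1 ->
  (forall a b, Q i a = a -> Q j b = b -> resample2 i j a = 0 -> resample2 i j b = 0 ->
     2 * dot a b <= eps * (dot a a + dot b b)) -> 0 < s ->
  - eps * (s * dot (f - Q i f) (f - Q i f) + s^-1 * dot (f - Q j f) (f - Q j f)) <=
  2 * dot (f - Q i f) (f - Q j f).
Proof.
move=> eps0 eps1 corr s0.
apply: (complement_correlation (wdotC w) (wdotDl w) (wdotZl w)
  (wdot_ge0 w_gt0) (wdot_eq0 w_gt0) (resample_self_adjoint i) (resample_self_adjoint j)
  (resample_idem i) (resample_idem j) _ _ _ _ _ eps0 eps1 corr) => //.
- by move=> g; apply: (condexp_tower w_gt0) => x y; exact: key_setU.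
- by move=> g; apply: (condexp_tower w_gt0) => x y; exact: key_setU'.
- by move=> g; exact: (condexp_tower w_gt0).
- by move=> g; apply: (condexp_tower' w_gt0) => x y; exact: key_setU.
- by move=> g; apply: (condexp_tower' w_gt0) => x y; exact: key_setU'.
Qed.

(** Local to global: the facets split into blocks with a common key, each block being the set of
    facets above a face of codimension 2. *)
Lemma block_to_global i j (a b : H) (eps : R) : i != j ->
  (forall x : facet,
     2 * \sum_(y : facet | key (T i :|: T j) x \subset val y) w y * (a y * b y) <=
     eps * (\sum_(y : facet | key (T i :|: T j) x \subset val y) w y * (a y * a y) +
            \sum_(y : facet | key (T i :|: T j) x \subset val y) w y * (b y * b y))) ->
  2 * dot a b <= eps * (dot a a + dot b b).
Proof.
have [sel selP] := facet_selector X_pure X_partite.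
move=> ij blk; rewrite /wdot -big_split !mulr_sumr /=.
apply: (@ler_sum_blocks _ _ _ (key (T i :|: T j))) => x.
rewrite -!mulr_sumr big_split /=.
by rewrite !(eq_bigl _ _ (key_subset X_partite selP x ij)).
Qed.

Lemma expander_correlation i j (f : H) (s : R) : top_link_expander X d mu (1 / 2) ->
  i != j -> 0 < s ->
  - 2^-1 * (s * dot (f - Q i f) (f - Q i f) + s^-1 * dot (f - Q j f) (f - Q j f)) <=
  2 * dot (f - Q i f) (f - Q j f).
Proof.
move=> X_exp ij; apply: resample_correlation; [lra|lra|].
move=> a b Qa Qb Qa2 Qb2; apply: (block_to_global ij) => x.
have [sel selP] := facet_selector X_pure X_partite.
apply: (expander_block_correlation X_complex X_pure X_partite mu_dist selP) => //.
- by move=> y z; exact: resample_fixed.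
- by move=> y z; exact: resample_fixed.
- rewrite -(eq_bigl _ _ (key_subset X_partite selP x ij)).
  exact: (condexp_block_sum w_gt0).
- rewrite -(eq_bigl _ _ (key_subset X_partite selP x ij)).
  exact: (condexp_block_sum w_gt0).
Qed.

Lemma independent_correlation i j (f : H) : i != j ->
  (forall (x : facet) F K, F \in T i -> K \in T j -> let t := key (T i :|: T j) x in
     cprob X d mu (fun s => (F \in s) && (K \in s)) t =
     cprob X d mu (fun s => F \in s) t * cprob X d mu (fun s => K \in s) t) ->
  0 <= dot (f - Q i f) (f - Q j f).
Proof.
move=> ij indep.
(* This is the case [eps = 0], where the weight is immaterial and is set to 1. *)
suff : - 0 * (1 * dot (f - Q i f) (f - Q i f) + 1^-1 * dot (f - Q j f) (f - Q j f)) <=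
  2 * dot (f - Q i f) (f - Q j f) by rewrite oppr0 mul0r; lra.
apply: resample_correlation => //.
move=> a b Qa Qb Qa2 Qb2; apply: (block_to_global ij) => x.
have [sel selP] := facet_selector X_pure X_partite.
rewrite mul0r (independent_block_correlation X_partite mu_dist selP) ?mulr0 //.
- by move=> y z; exact: resample_fixed.
- by move=> y z; exact: resample_fixed.
- rewrite -(eq_bigl _ _ (key_subset X_partite selP x ij)).
  exact: (condexp_block_sum w_gt0).
- by move=> F K Fi Kj; exact: indep.
Qed.

(** * The Laplacian and the Markov operator of the walk *)

Definition laplacian : 'End(H) := \sum_i (\1%VF - Q i).
Local Notation L := laplacian.

Lemma laplacianE f : L f = \sum_i (f - Q i f).
Proof. by rewrite sum_lfunE; apply: eq_bigr => i _; rewrite add_lfunE opp_lfunE id_lfunE. Qed.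

Let dotDl := wdotDl w.
Let dotC := wdotC w.
Let dotZl := wdotZl w.

Lemma complement_dot i f : dot (f - Q i f) f = dot (f - Q i f) (f - Q i f).
Proof.
rewrite (ipBr dotC dotDl dotZl) [X in _ = _ - X](ipBl dotDl dotZl).
by rewrite [X in _ - (_ - X)]resample_self_adjoint resample_idem [dot f _]dotC subrr subr0.
Qed.

Lemma laplacian_dot f : dot (L f) f = \sum_i dot (f - Q i f) (f - Q i f).
Proof.
rewrite laplacianE (ip_suml dotDl dotZl).
by apply: eq_bigr => i _; rewrite complement_dot.
Qed.

Lemma laplacian_self_adjoint : self_adjoint dot L.
Proof.
move=> f g; rewrite !laplacianE (ip_suml dotDl dotZl) (ip_sumr dotC dotDl dotZl).
apply: eq_bigr => i _; rewrite (ipBl dotDl dotZl) (ipBr dotC dotDl dotZl).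
by rewrite resample_self_adjoint.
Qed.

Lemma laplacian_ge0 f : 0 <= dot (L f) f.
Proof. by rewrite laplacian_dot; apply: sumr_ge0 => i _; exact: wdot_ge0. Qed.

Lemma mu_sum1 : \sum_(x : facet) w x = 1.
Proof.
by case: mu_dist => _ <-; rewrite (big_sub (mem (faces X d))).
Qed.

Definition mean (f : H) : R := \sum_x w x * f x.

Definition markov : 'End(H) := d%:R^-1 *: \sum_i Q i.
Local Notation M := markov.
Local Notation K := (fun x y : facet => down_up X T mu (val x) (val y)).

Let d_neq0 : d%:R != 0 :> R. Proof. by rewrite pnatr_eq0 -lt0n. Qed.

Lemma markovE f : M f = d%:R^-1 *: \sum_i Q i f.
Proof. by rewrite scale_lfunE sum_lfunE. Qed.

(** The bridge from the combinatorial walk to operators: the facets reachable by replacing the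
    vertex in part [i] are the block of the key of [T i]. *)
Lemma markov_kernel f x : M f x = \sum_y K x y * f y.
Proof.
transitivity (\sum_i d%:R^-1 * (Q i f x : R)).
  by rewrite markovE ffunE sum_ffunE -[RHS]mulr_sumr.
transitivity (\sum_i \sum_(y : facet) d%:R^-1 *
  ((if key (T i) y == key (T i) x then w y / block_mass w (key (T i)) x else 0) * f y)).
  apply: eq_bigr => i _; rewrite condexpE -mulr_sumr; congr (_ * _).
  rewrite mulr_suml big_mkcond /=; apply: eq_bigr => y _.
  by case: ifP => _; rewrite ?mul0r // mulrAC.
rewrite exchange_big /=; apply: eq_bigr => y _; rewrite mulr_suml.
apply: eq_bigr => i _; rewrite mulrA; congr (_ * _).
rewrite (replaces_key X_pure X_partite); case: ifP => // _; congr (_ * (_ / _)).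
rewrite (big_sub_cond (mem (faces X d)) (replaces T i (val x))).
by apply: eq_bigl => z; rewrite (replaces_key X_pure X_partite).
Qed.

Lemma markov_self_adjoint : self_adjoint dot M.
Proof.
move=> f g; rewrite !markovE dotZl (ipZr dotC dotZl).
rewrite (ip_suml dotDl dotZl) (ip_sumr dotC dotDl dotZl); congr (_ * _).
by apply: eq_bigr => i _; exact: resample_self_adjoint.
Qed.

Lemma markov_ge0 f : 0 <= dot (M f) f.
Proof.
rewrite markovE dotZl (ip_suml dotDl dotZl) mulr_ge0 ?invr_ge0 ?ler0n //.
apply: sumr_ge0 => i _.
by rewrite -resample_idem resample_self_adjoint wdot_ge0.
Qed.

Lemma laplacian_markov f : dot (L f) f = d%:R * (dot f f - dot (M f) f).
Proof.
rewrite laplacianE markovE dotZl !(ip_suml dotDl dotZl).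
under eq_bigr => i _ do rewrite (ipBl dotDl dotZl).
rewrite sumrB sumr_const card_ord mulrBr mulrA mulfV // mul1r.
by rewrite mulr_natl.
Qed.

Definition one : H := [ffun=> 1].

Lemma markov_one : M one = one.
Proof.
rewrite markovE (eq_bigr (fun=> one)).
  by rewrite sumr_const card_ord -scaler_nat scalerA mulVf // scale1r.
by move=> i _; apply: condexp_id => // x y _; rewrite !ffunE.
Qed.

Lemma mean_one : mean one = 1.
Proof. by rewrite -mu_sum1; apply: eq_bigr => x _; rewrite ffunE mulr1. Qed.

Lemma dot_one f : dot f one = mean f.
Proof. by apply: eq_bigr => x _; rewrite ffunE mulr1. Qed.

Lemma dot_center f : dot (f - mean f *: one) (f - mean f *: one) = dot f f - mean f ^+ 2.
Proof.
rewrite (ipBl dotDl dotZl) !(ipBr dotC dotDl dotZl) !dotZl !(ipZr dotC dotZl).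
by rewrite [dot one f]dotC !dot_one mean_one; ring.
Qed.

Lemma markov_mean f : mean (M f) = mean f.
Proof. by rewrite -!dot_one markov_self_adjoint markov_one. Qed.

(** Expand the square. The terms in [f x] give [dot f f] because the rows of the kernel sum to 1,
    those in [f y] because [mu] is stationary, and the cross terms give [dot (M f) f]. *)
Lemma dirichletE (g : {set V} -> R) (f : H) : (forall x, f x = g (val x)) ->
  dirichlet X T mu g = d%:R^-1 * dot (L f) f.
Proof.
move=> fg; rewrite laplacian_markov mulrA mulVf // mul1r.
pose f2 : H := [ffun x => (f x : R) ^+ 2].
have E1 : \sum_x \sum_y w x * K x y * (f x : R) ^+ 2 = dot f f.
  transitivity (\sum_x w x * (f x : R) ^+ 2 * M one x).
    apply: eq_bigr => x _; rewrite markov_kernel mulr_sumr.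
    by apply: eq_bigr => y _; rewrite ffunE mulr1 mulrAC.
  by rewrite markov_one; apply: eq_bigr => x _; rewrite ffunE mulr1.
have E2 : \sum_x \sum_y w x * K x y * (f y : R) ^+ 2 = dot f f.
  transitivity (mean (M f2)).
    apply: eq_bigr => x _; rewrite markov_kernel mulr_sumr.
    by apply: eq_bigr => y _; rewrite ffunE mulrA.
  by rewrite markov_mean; apply: eq_bigr => x _; rewrite ffunE.
have E3 : \sum_x \sum_y w x * K x y * ((f x : R) * (f y : R)) = dot (M f) f.
  rewrite dotC; apply: eq_bigr => x _; rewrite markov_kernel !mulr_sumr.
  have r (a b c e : R) : a * b * (c * e) = a * (c * (b * e)) by ring.
  by apply: eq_bigr => y _; exact: r.
have -> : dirichlet X T mu g = 2^-1 * \sum_x \sum_y (w x * K x y * (f x : R) ^+ 2 +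
    w x * K x y * (f y : R) ^+ 2 - 2 * (w x * K x y * ((f x : R) * (f y : R)))).
  rewrite /dirichlet (big_sub (mem (faces X d))); congr (_ * _); apply: eq_bigr => x _.
  rewrite (big_sub (mem (faces X d))); apply: eq_bigr => y _; rewrite !fg.
  by ring.
under eq_bigr => x _ do rewrite big_split big_split /= sumrN -mulr_sumr.
by rewrite big_split big_split /= sumrN -mulr_sumr E1 E2 E3; field.
Qed.

Lemma varianceE (g : {set V} -> R) (f : H) : (forall x, f x = g (val x)) ->
  variance_on X d mu g = dot f f - mean f ^+ 2.
Proof.
move=> fg; rewrite /variance_on !(big_sub (mem (faces X d))).
by congr (_ - _ ^+ 2); apply: eq_bigr => x _; rewrite fg.
Qed.

(** * Chi-square distance to stationarity *)

Definition point (x : facet) : H := [ffun y => (y == x)%:R].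

Lemma dot_point f x : dot f (point x) = w x * f x.
Proof.
rewrite /wdot (bigD1 x) //= ffunE eqxx mulr1 big1 ?addr0 // => y /negPf yx.
by rewrite ffunE yx !mulr0.
Qed.

Lemma down_up_iterE n x y : down_up_iter X T mu n (val x) (val y) = iter n M (point y) x.
Proof.
elim: n x => [|n IHn] x /=; first by rewrite ffunE.
rewrite markov_kernel (big_sub (mem (faces X d))); apply: eq_bigr => z _.
by rewrite IHn.
Qed.

Lemma iter_markov_self_adjoint n f g : dot (iter n M f) g = dot f (iter n M g).
Proof.
elim: n f g => // n IHn f g; rewrite iterS markov_self_adjoint IHn.
by rewrite -iterSr iterS.
Qed.

(** The density of the point mass at [tau] with respect to [mu], minus its stationary value 1. *)
Definition density tau : H := (w tau)^-1 *: point tau - one.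

(** By reversibility the density of the distribution after [n] steps evolves under [M] itself, and
    [M] fixes the constant 1. *)
Lemma iter_markov_density n tau x :
  down_up_iter X T mu n (val tau) (val x) - w x = w x * iter n M (density tau) x.
Proof.
have iter_one : iter n M one = one by elim: n => //= n ->; exact: markov_one.
have -> : iter n M (density tau) = (w tau)^-1 *: iter n M (point tau) - one.
  rewrite -[X in _ - X]iter_one; elim: (n) => //= k ->.
  by rewrite linearB linearZ.
have wt0 : w tau != 0 by rewrite gt_eqF.
(* Detailed balance for [n] steps, from the self-adjointness of the iterates. *)
have E : w tau * down_up_iter X T mu n (val tau) (val x) = w x * iter n M (point tau) x.
  by rewrite down_up_iterE -!dot_point iter_markov_self_adjoint dotC.
have E' : down_up_iter X T mu n (val tau) (val x) =
    (w tau)^-1 * (w x * iter n M (point tau) x).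
  by rewrite -E mulKf.
rewrite E' !ffunE.
have r (a b c : R) : a * (b * c) - b = b * (a * c - 1) by ring.
exact: r.
Qed.

Lemma mean_density tau : mean (density tau) = 0.
Proof.
rewrite -dot_one (ipBl dotDl dotZl) dotZl [dot (point _) _]dotC dot_point !dot_one.
by rewrite ffunE mulr1 mulVf ?gt_eqF // mean_one subrr.
Qed.

Lemma norm_density tau : dot (density tau) (density tau) = (w tau)^-1 - 1.
Proof.
rewrite {2}/density (ipBr dotC dotDl dotZl) dot_one mean_density subr0.
rewrite (ipZr dotC dotZl) dot_point mulKf ?gt_eqF //.
by rewrite !ffunE eqxx [_ *: _]mulr1.
Qed.

(** The [l1] distance is the mean of the absolute value of [u], and the variance of that function is
    nonnegative. *)
Lemma l1_distance_sqr n tau : l1_distance X T mu (val tau) n ^+ 2 <=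
  dot (iter n M (density tau)) (iter n M (density tau)).
Proof.
set u := iter n M (density tau); pose a : H := [ffun x => `|(u x : R)|].
have -> : l1_distance X T mu (val tau) n = mean a.
  rewrite /l1_distance (big_sub (mem (faces X d))); apply: eq_bigr => x _.
  by rewrite iter_markov_density normrM gtr0_norm // ffunE.
have -> : dot u u = dot a a.
  by apply: eq_bigr => x _; rewrite ffunE -!expr2 real_normK // num_real.
by have := wdot_ge0 w_gt0 (a - mean a *: one); rewrite dot_center subr_ge0.
Qed.

(** * The Poincare inequality *)

Section PathExpander.
Hypothesis X_path : path_complex X T mu.
Hypothesis X_expander : top_link_expander X d mu (1 / 2).

Lemma laplacian_square f :
  4 / d.+1%:R ^+ 2 * dot (L f) f <= dot (L f) (L f).
Proof.
have [p pathp] := X_path; have [sel selP] := facet_selector X_pure X_partite.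
pose u (i : 'I_d) := f - Q (p i) f.
have EL : L f = \sum_i u i by rewrite laplacianE (reindex_inj (@perm_inj _ p)).
have -> : dot (L f) (L f) = \sum_i \sum_j dot (u i) (u j).
  rewrite EL (ip_suml dotDl dotZl); apply: eq_bigr => i _.
  exact: (ip_sumr dotC dotDl dotZl).
have -> : dot (L f) f = \sum_i dot (u i) (u i).
  by rewrite laplacian_dot (reindex_inj (@perm_inj _ p)).
apply: (@path_form_ge _ d (fun i j => dot (u i) (u j))).
- by move=> i j; exact: dotC.
- by move=> i; exact: wdot_ge0.
- move=> i j ij s s0; apply: expander_correlation => //.
  apply/eqP => /perm_inj E; move: ij; rewrite E => /eqP.
  by rewrite gtn_eqF.
- move=> i j ij; apply: independent_correlation.
    by apply/eqP => /perm_inj E; move: ij; rewrite E ltnNge ltnW.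
  move=> x F K Fi Kj t; apply: (pathp i j ij) => //.
    by apply: X_complex (facet_in x) (subsetDl _ _).
  (* Part [p (i + 1)] lies strictly between and survives the removal of parts [p i] and [p j]; its
     vertex is the witness required by the path condition. *)
  have ltid : (i.+1 < d)%N by exact: ltn_trans ij (ltn_ord j).
  exists (Ordinal ltid); rewrite /= ?ltnSn ?ij //.
  apply/set0Pn; exists (sel (p (Ordinal ltid)) x).
  rewrite inE (sel_part selP) andbT inE (sel_in selP) andbT inE negb_or.
  apply/andP; split; apply/negP => h.
    have /perm_inj/(congr1 val) /= := part_disjoint X_partite h (sel_part selP _ _).
    by move/eqP; rewrite ltn_eqF.
  have /perm_inj/(congr1 val) /= := part_disjoint X_partite h (sel_part selP _ _).
  by move/eqP; rewrite gtn_eqF.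
Qed.

Hypothesis X_connected : connected_complex X d.

Lemma laplacian_ker f : L f = 0 -> forall x y, f x = f y.
Proof.
move=> Lf; have : dot (L f) f = 0 by rewrite Lf (ip0l dotZl).
rewrite laplacian_dot => /eqP; rewrite psumr_eq0 => [/allP Q0|i _]; last exact: wdot_ge0.
apply: (facet_constant X_complex X_pure X_partite X_connected) => i x y.
apply: resample_fixed; apply/eqP; rewrite eq_sym -subr_eq0; apply/eqP.
by apply: (wdot_eq0 w_gt0); apply/eqP/Q0; rewrite mem_index_enum.
Qed.

(** The kernel part [f0] is a constant [c], and [|f - c|^2] equals the variance plus
    [(mean f - c)^2], so the mean is at least as good a constant. *)
Lemma poincare f : 4 / d.+1%:R ^+ 2 * (dot f f - mean f ^+ 2) <= dot (L f) f.
Proof.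
have g0 : 0 < 4 / d.+1%:R ^+ 2 :> R by rewrite divr_gt0 // exprn_gt0 // ltr0Sn.
have [f0 Lf0] := spectral_gap_of_square dotC dotDl dotZl (wdot_eq0 w_gt0) f
  laplacian_self_adjoint laplacian_ge0 g0 laplacian_square.
apply: le_trans; rewrite ler_wpM2l ?(ltW g0) //.
have [x _|nox] := pickP (@predT facet); last first.
  by have := mu_sum1; rewrite big_pred0 // => /eqP; rewrite eq_sym oner_eq0.
have f0E y : f0 y = f0 x by exact: laplacian_ker.
pose c : R := f0 x.
have E1 : dot f f0 = c * mean f.
  rewrite /mean mulr_sumr; apply: eq_bigr => y _; rewrite f0E.
  have r (a b e : R) : a * (b * e) = e * (a * b) by ring.
  exact: r.
have E2 : dot f0 f0 = c ^+ 2.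
  transitivity (\sum_(y : facet) w y * c ^+ 2); last by rewrite -mulr_suml mu_sum1 mul1r.
  by apply: eq_bigr => y _; rewrite f0E.
rewrite (ipBl dotDl dotZl) !(ipBr dotC dotDl dotZl) [dot f0 f]dotC E1 E2.
have := sqr_ge0 (mean f - c); nra.
Qed.

(** * From the gap to the mixing time *)

Local Notation gap := (4 / (d * d.+1 ^ 2)%:R : R).

Lemma gapE : gap = d%:R^-1 * (4 / d.+1%:R ^+ 2).
Proof. by rewrite natrM natrX invfM mulrCA. Qed.

Lemma gap_gt0 : 0 < gap.
Proof. by rewrite divr_gt0 // ltr0n muln_gt0 d_gt0 expn_gt0. Qed.

Lemma gap_le1 : gap <= 1.
Proof.
rewrite ler_pdivrMr ?ltr0n ?muln_gt0 ?d_gt0 ?expn_gt0 // mul1r ler_nat.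
by rewrite (@leq_mul 1 4) // (@leq_exp2r 2 d.+1 2).
Qed.

Lemma gap_le d' : (d' <= d)%N -> (0 < d')%N -> gap <= 4 / (d' * d'.+1 ^ 2)%:R.
Proof.
move=> dd' d'0; rewrite ler_wpM2l // lef_pV2 ?posrE ?ltr0n ?muln_gt0 ?d_gt0 ?d'0 ?expn_gt0 //.
by rewrite ler_nat leq_mul // leq_exp2r.
Qed.

Lemma walk_spectral_gap : (gap%:E <= spectral_gap X T mu)%E.
Proof.
apply/ereal_infP => _ [g [x [y [xF yF gxy]]] ->]; rewrite lee_fin.
pose f : H := [ffun x : facet => g (val x)].
have fg z : f z = g (val z) by rewrite ffunE.
rewrite (dirichletE fg) (varianceE fg).
have var0 : 0 < dot f f - mean f ^+ 2.
  rewrite -dot_center lt_def wdot_ge0 // andbT; apply/eqP => /(wdot_eq0 w_gt0)/eqP.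
  rewrite subr_eq0 => /eqP/ffunP fc; apply: gxy.
  have := fc (exist _ x xF); have := fc (exist _ y yF).
  by rewrite !ffunE /= => -> ->.
rewrite ler_pdivlMr // gapE -mulrA ler_wpM2l ?invr_ge0 ?ler0n //.
exact: poincare.
Qed.

Lemma markov_upper f : mean f = 0 -> dot (M f) f <= (1 - gap) * dot f f.
Proof.
move=> f0; have := poincare f; rewrite f0 expr0n subr0 laplacian_markov.
rewrite -ler_pdivrMl ?ltr0n // mulrA -gapE => h.
by rewrite mulrBl mul1r lerBrDr addrC -lerBrDr.
Qed.

(** [M] preserves mean zero, and since it is positive semidefinite the upper bound on its form
    controls its norm. *)
Lemma iter_markov_contraction n f : mean f = 0 ->
  dot (iter n M f) (iter n M f) <= (1 - gap) ^+ n ^+ 2 * dot f f.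
Proof.
move=> f0; have r0 : 0 <= 1 - gap by rewrite subr_ge0 gap_le1.
elim: n => [|n IHn]; first by rewrite expr0 expr1n mul1r.
have m0 : mean (iter n M f) = 0 by elim: (n) => //= k; rewrite markov_mean.
rewrite iterS [(1 - gap) ^+ n.+1]exprS exprMn -mulrA.
apply: le_trans (ler_wpM2l (sqr_ge0 _) IHn).
apply: (self_adjoint_contraction dotC dotDl dotZl markov_self_adjoint markov_ge0 r0).
  exact: markov_upper.
by apply: markov_upper; rewrite markov_mean.
Qed.

(** The initial squared norm is [1 / m - 1] with [m] the mass of [tau]. As [4 m (1 - m) <= 1], a
    factor 2 is gained in the hypothesis, which later pays for rounding down. *)
Lemma l1_distance_le n (tau : facet) (eps : R) : 0 < eps ->
  (1 - gap) ^+ n <= 2 * (eps * w tau) ->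
  l1_distance X T mu (val tau) n <= eps.
Proof.
move=> eps0 hn; have wt := w_gt0 tau.
have l0 : 0 <= l1_distance X T mu (val tau) n by apply: sumr_ge0.
rewrite -(@ler_pXn2r _ 2) ?nnegrE ?(ltW eps0) //.
apply: le_trans (l1_distance_sqr n tau) _.
apply: le_trans (iter_markov_contraction n (mean_density tau)) _.
rewrite norm_density.
have w1 : 0 <= (w tau)^-1 - 1 by rewrite -norm_density wdot_ge0.
have hn2 : (1 - gap) ^+ n ^+ 2 <= (2 * (eps * w tau)) ^+ 2.
  by rewrite ler_pXn2r ?nnegrE ?exprn_ge0 ?subr_ge0 ?gap_le1 // !mulr_ge0 // ltW.
apply: le_trans (ler_wpM2r w1 hn2) _.
have r (e m : R) : m != 0 ->
    (2 * (e * m)) ^+ 2 * (m^-1 - 1) = e ^+ 2 * (4 * (m * (1 - m))).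
  by move=> m0; field.
rewrite r ?gt_eqF //.
rewrite -[leRHS]mulr1 ler_wpM2l ?sqr_ge0 //.
have := sqr_ge0 (2 * w tau - 1); nra.
Qed.

Lemma one_sub_gap_expR n : (1 - gap) ^+ n <= expR (- (gap * n%:R)).
Proof.
rewrite -[- (gap * n%:R)]mulNr expRM_natr.
apply: lerXn2r; rewrite ?nnegrE ?subr_ge0 ?gap_le1 ?expR_ge0 //.
exact: expR_ge1Dx.
Qed.

Lemma expR_mixing_bound (tau : facet) (eps : R) : 0 < eps ->
  expR (- (gap * mixing_bound d mu (val tau) eps)) = eps * w tau.
Proof.
move=> eps0; have ew : 0 < eps * w tau by rewrite mulr_gt0.
have r (N : R) : N != 0 -> 4 / N * (N / 4) = 1 by move=> N0; field.
rewrite /mixing_bound mulrA r; last by rewrite pnatr_eq0 muln_eq0 expn_eq0 /= orbF -lt0n.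
by rewrite !mul1r lnV ?posrE // opprK lnK ?posrE.
Qed.

Lemma mixing_time_le n (tau : facet) (eps : R) : l1_distance X T mu (val tau) n <= eps ->
  (mixing_time X T mu (val tau) eps <= n%:R%:E)%E.
Proof. by move=> h; apply: ereal_inf_lbound; exists n. Qed.

(** Rounding the bound down loses less than one step, hence a factor at most [expR gap]. For
    [d >= 2] the gap is at most [4 / 18], so this factor is below the spare 2 of [l1_distance_le];
    the condition on [eps] makes the bound nonnegative. *)
Lemma mixing_time_floor (tau : facet) (eps : R) : (1 < d)%N -> 0 < eps -> eps * w tau <= 1 ->
  (mixing_time X T mu (val tau) eps <= (mixing_bound d mu (val tau) eps)%:E)%E.
Proof.
move=> d1 eps0 ew1; have ew : 0 < eps * w tau by rewrite mulr_gt0.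
set b := mixing_bound _ _ _ _.
have b0 : 0 <= b.
  by rewrite mulr_ge0 ?divr_ge0 ?ler0n // ln_ge0 // div1r invf_ge1.
have /andP[nb bn] := truncn_itv b0; set n := Num.trunc b in nb bn.
apply: le_trans (_ : n%:R%:E <= _)%E; last by rewrite lee_fin.
apply/mixing_time_le/l1_distance_le => //.
apply: le_trans (one_sub_gap_expR n) _.
have g0 := gap_gt0.
apply: (@le_trans _ _ (expR (gap + - (gap * b)))).
  rewrite ler_expR; move: bn; rewrite -natr1 => bn.
  have h : gap * b <= gap * (n%:R + 1) by rewrite ler_wpM2l // ltW.
  have r (x y z : R) : y <= z * (x + 1) -> - (z * x) <= z - y by lra.
  exact: r.
rewrite expRD expR_mixing_bound // ler_wpM2r ?(ltW ew) //.
have g2 : gap <= 4 / (2 * 3 ^ 2)%:R by exact: gap_le.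
(* [expR gap <= 2] is obtained through inverses, from [expR (- gap) >= 1 - gap >= 1 / 2]. *)
have := expR_ge1Dx (- gap); rewrite expRN => hg.
rewrite -[leLHS]invrK -[leRHS]invrK lef_pV2 ?posrE ?invr_gt0 ?expR_gt0 //.
have r (x : R) : x <= 4 / 18 -> 2^-1 <= 1 + - x by lra.
exact: le_trans (r _ g2) hg.
Qed.

(** Rounding up makes the exponential at most [eps * mu tau] directly; the maximum with 0 handles a
    negative bound, where zero steps are taken. *)
Lemma mixing_time_ceil (tau : facet) (eps : R) : 0 < eps ->
  (mixing_time X T mu (val tau) eps <=
     (Num.max 0 (Num.ceil (mixing_bound d mu (val tau) eps)))%:~R%:E)%E.
Proof.
move=> eps0; set b := mixing_bound _ _ _ _; set m := Num.max _ _.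
have m0 : 0 <= m by rewrite le_max lexx.
rewrite -[m]gez0_abs // -pmulrn.
apply/mixing_time_le/l1_distance_le => //.
apply: le_trans (one_sub_gap_expR _) _.
have : expR (- (gap * `|m|%N%:R)) <= expR (- (gap * b)).
  rewrite ler_expR lerN2 ler_wpM2l ?(ltW gap_gt0) //.
  rewrite pmulrn gez0_abs //; apply: le_trans (ceil_ge b) _.
  by rewrite ler_int le_max lexx orbT.
rewrite expR_mixing_bound // => /le_trans; apply.
by rewrite ler_peMl ?ler1n // mulr_ge0 // ltW.
Qed.

End PathExpander.
End Walk.

Theorem mainTheorem3 (R : realType) (V : finType) (X : {set {set V}})
    (d : nat) (T : 'I_d -> {set V}) (mu : {set V} -> R)
    (d_gt0 : (0 < d)%N)
    (X_complex : simplicial_complex X)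
    (X_pure : pure X d)
    (X_partite : partite X T)
    (mu_dist : facet_distribution X d mu)
    (X_connected : connected_complex X d)
    (X_path : path_complex X T mu)
    (X_expander : top_link_expander X d mu (1 / 2)) :
  ((4 / (d * d.+1 ^ 2)%:R)%:E <= spectral_gap X T mu)%E /\
  forall (tau : {set V}) (eps : R), tau \in faces X d -> 0 < eps ->
    ((1 < d)%N -> eps * mu tau <= 1 ->
       (mixing_time X T mu tau eps <= (mixing_bound d mu tau eps)%:E)%E) /\
    (mixing_time X T mu tau eps <=
       ((Num.max 0 (Num.ceil (mixing_bound d mu tau eps)))%:~R)%:E)%E.
Proof.
split=> [|tau eps tauF eps0]; first exact: walk_spectral_gap.
pose x : {x : {set V} | x \in faces X d} := exist _ tau tauF.
split=> [d1 ew|].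
  exact: (mixing_time_floor d_gt0 X_complex X_pure X_partite mu_dist
    X_path X_expander X_connected (tau := x)).
exact: (mixing_time_ceil d_gt0 X_complex X_pure X_partite mu_dist
  X_path X_expander X_connected x).
Qed.
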